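(* Let $q=p^n$, where $p$ is a prime, and let $G=PGL(2,q)$. Let $\Phi(x)=f(x)/g(x)$ be a nonconstant coefficient in the orbit polynomial of $G$, where $f,g\in\mathbb{F}_q[x]$ are relatively prime and one of $f,g$ is monic (so that $f$ and $g$ have coefficients in $\mathbb{F}_p$). Let $P=f(T)-xg(T)$ and consider $P$ as an element of $\mathbb{F}_p(x)[T]$. Then the Galois group $\Gamma$ of $P$ over $\mathbb{F}_p(x)$ is isomorphic to the automorphism group $\mathrm{Aut}(G)$ of $G$ and has order $n|G|$.
   Context: $PGL(2,q)=PGL(2,\mathbb{F}_q)$, whose elements are written as linear fractional transformations $s(x)=\frac{ax+b}{cx+d}$ with $a,b,c,d\in\mathbb{F}_q$, $ad-bc\ne0$. The orbit polynomial of $G$ is $P_G(T)=\prod_{s\in G}(T-s(x))\in\mathbb{F}_q(x)[T]$; a coefficient is nonconstant if it does not lie in $\mathbb{F}_q$. *)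

(* Defs.v *)
From HB Require Import structures.
From mathcomp Require Import all_boot all_order all_fingroup all_algebra.
From mathcomp Require Import all_solvable all_field.

Set Implicit Arguments.
Unset Strict Implicit.
Unset Printing Implicit Defensive.

Import GRing.Theory.
Local Open Scope ring_scope.

Section RationalFunctions.
Variable K : fieldType.

Definition ratC (c : K) : {fraction {poly K}} := tofrac c%:P.
Definition ratX : {fraction {poly K}} := tofrac 'X.

Definition moebius (A : 'M[K]_2) : {fraction {poly K}} :=
  (ratC (A 0 0) * ratX + ratC (A 0 1)) / (ratC (A 1 0) * ratX + ratC (A 1 1)).

Lemma moebiusZ (c : K) (A : 'M[K]_2) : c != 0 -> moebius (c *: A) = moebius A.
Proof.
move=> c0; have C0 : ratC c != 0 by rewrite tofrac_eq0 polyC_eq0.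
rewrite /moebius !mxE; have CM a b : ratC (a * b) = ratC a * ratC b.
  by rewrite /ratC polyCM tofracM.
by rewrite !CM -!mulrA -!mulrDr -mulf_div divff // mul1r.
Qed.

End RationalFunctions.

Section PGL.
Variable F : finFieldType.

Definition PGL2 : {group coset_of 'Z('GL_2[F])} := ('GL_2[F] / 'Z('GL_2[F]))%G.

(* [repr s] is a matrix in the class [s]; by [lft_coset] the choice of the
   representative is irrelevant. *)
Definition lft (s : coset_of 'Z('GL_2[F])) : {fraction {poly F}} :=
  moebius (GLval (repr s)).

Definition orbit_poly (G : {group coset_of 'Z('GL_2[F])}) :
    {poly {fraction {poly F}}} :=
  \prod_(s in G) ('X - (lft s)%:P).

Let E (i j : 'I_2) : 'M[F]_2 := 1%:M + delta_mx i j.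

Lemma center_GL2 (z : {'GL_2[F]}) :
  (z \in 'Z('GL_2[F]))%g -> exists2 c : F, c != 0 & GLval z = c%:M.
Proof.
case/centerP=> _ zC; pose Z : 'M[F]_2 := GLval z.
have ord2 (k : 'I_2) : k = 0 \/ k = 1.
  by case: k => [[|[|k]]] // ?; [left|right]; apply/val_inj.
have unitE (i j : 'I_2) : i != j -> E i j \in unitmx.
  move=> ij; have [] // := @mulmx1_unit F 2 (E i j) (1%:M - delta_mx i j).
  rewrite mulmxBr mulmx1 mulmxDl mul1mx mul_delta_mx_cond eq_sym (negPf ij).
  by rewrite mulr0n addr0 addrK.
have comm (i j : 'I_2) : i != j -> Z *m delta_mx i j = delta_mx i j *m Z.
  move=> ij; have := zC (FinRing.unit _ (unitE i j ij)) (in_setT _).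
  move/(congr1 (@GLval 2 F)); rewrite !GL_MxE /= -/Z.
  by rewrite mulmxDr mulmxDl mulmx1 mul1mx => /addrI.
have ZE i j k l : i != j -> (Z *m delta_mx i j) k l = Z k i *+ (l == j).
  move=> _; rewrite mxE (bigD1 i) //= big1 ?addr0.
    by rewrite mxE eqxx /= mulr_natr.
  by move=> m mi; rewrite mxE (negPf mi) mulr0.
have ZE' i j k l : i != j -> (delta_mx i j *m Z) k l = Z j l *+ (k == i).
  move=> _; rewrite mxE (bigD1 j) //= big1 ?addr0.
    by rewrite mxE eqxx andbT mulr_natl.
  by move=> m mi; rewrite mxE (negPf mi) andbF mul0r.
have Zkl i j k l : i != j -> Z k i *+ (l == j) = Z j l *+ (k == i).
  by move=> ij; rewrite -ZE // -ZE' // comm.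
have Z01 : Z 0 1 = 0 by have := Zkl 1 0 0 0 isT; rewrite eqxx /= mulr1n mulr0n.
have Z10 : Z 1 0 = 0 by have := Zkl 0 1 1 1 isT; rewrite eqxx /= mulr1n mulr0n.
have Z11 : Z 1 1 = Z 0 0 by have := Zkl 1 0 1 0 isT; rewrite !eqxx /= !mulr1n.
have defZ : Z = (Z 0 0)%:M.
  apply/matrixP=> k l; rewrite [RHS]mxE.
  by case: (ord2 k) => ->; case: (ord2 l) => ->; rewrite ?Z01 ?Z10 ?Z11.
exists (Z 0 0) => //; apply: contraTneq (GL_unitmx z) => Z00.
by rewrite -[\val z]/Z defZ Z00 unitmxE det_scalar expr0n unitr0.
Qed.

Lemma lft_coset (A : {'GL_2[F]}) :
  lft (coset 'Z('GL_2[F])%g A) = moebius (GLval A).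
Proof.
have nZ (B : {'GL_2[F]}) : (B \in 'N('Z('GL_2[F])))%g.
  by apply: (subsetP (gFnorm _ _)); rewrite inE.
have [] := rcosetP (_ : repr (coset 'Z('GL_2[F])%g A) \in 'Z('GL_2[F]) :* A)%g.
  by rewrite -val_coset // mem_repr_coset.
move=> z /center_GL2[c c0 defz] defr; rewrite /lft defr GL_MxE defz.
by rewrite mul_scalar_mx moebiusZ.
Qed.

End PGL.

(* The embedding of the prime field: a ring morphism if [F] has
   characteristic [p]. *)
Definition of_Fp (p : nat) (F : finFieldType) (a : 'F_p) : F := (a : nat)%:R.

Definition fiber_poly (K : fieldType) (f g : {poly K}) :
    {poly {fraction {poly K}}} :=
  map_poly (@ratC K) f - ratX K *: map_poly (@ratC K) g.

(* Main.v *)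
Require Import Defs.
From HB Require Import structures.
From mathcomp Require Import all_boot all_order all_fingroup all_algebra.
From mathcomp Require Import all_solvable all_field.
From mathcomp Require Import ring.

(** Let [q = #|F|], [G = PGL2 F] and [Phi = f / g].

The substitutions [X |-> s(X)] and the Frobenius acting on coefficients permute
the roots [s(X)] of the orbit polynomial, so they fix its coefficient [Phi]
([subst_coef]).  For the Frobenius this means that [f] and [g] have
coefficients in the prime field ([coef_frob_fixed]).  For the substitutions it
means that every [s(X)] is a root of [f(T) - Phi g(T)]; clearing denominators
in the orbit polynomial bounds the degree of this polynomial by [#|G|], so it
is a scalar multiple of the orbit polynomial ([generic_fiber_orbit]).

Let [t] be the variable of the base field [F_p(t)], and [y] a root of
[f(T) - t g(T)] in the splitting field [L].  Then [t = Phi(y)] and [y] is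
transcendental.  Since the roots include all [y + c] with [c] in [F], the field
[L] contains a copy of [F], hence a copy of [F(X)] in which [X] is [y] and [Phi]
is [t] ([exists_function_field_embedding]).  By the first part the roots are
the [s(y)], so this copy is all of [L] ([phi_surj]).

The substitutions [X |-> s(X)], combined with the [n] powers of the Frobenius on
the constants, therefore give [n * #|G|] elements of the Galois group
([card_Gal_ge]).  Those that fix the constants form a normal subgroup isomorphic
to [G] whose centraliser is trivial ([const_gal_norm], [const_gal_cent]), so
conjugation embeds the Galois group into [Aut G].  It remains to know that
[#|Aut G| <= n * #|G|] ([card_Aut_PGL2]): the chain
[n * #|G| <= #|Gal| <= #|Aut G| <= n * #|G|] then collapses.

For that bound, [Aut G] acts on the triples made of two distinct Sylow
[p]-subgroups and a nontrivial element of the first.  There are at most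
[(q + 1) q (q - 1) = #|G|] of them, and an automorphism that fixes the triple of
the upper unipotent group, the lower one and the translation by 1 is induced by
an automorphism of [F] ([flag_automorphism]), of which there are at most [n]. *)

Set Implicit Arguments.
Unset Strict Implicit.
Unset Printing Implicit Defensive.

Import GRing.Theory.
Local Open Scope ring_scope.

(** * Elements of PGL(2) as matrices up to scalars *)
Section ProjectiveMatrices.
Variable F : finFieldType.
Implicit Types (A B : 'M[F]_2) (a b c d k : F) (s : coset_of 'Z('GL_2[F])).

(** Total in [A]: a singular matrix is sent to the class of the identity. *)
Definition pclass A : coset_of 'Z('GL_2[F]) :=
  coset 'Z('GL_2[F]) (insubd (1%g : {'GL_2[F]}) A).

Lemma GLval_insubd A : A \in unitmx -> GLval (insubd (1%g : {'GL_2[F]}) A) = A.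
Proof. by move=> uA; rewrite /insubd insubT. Qed.

Lemma GLval_inj : injective (@GLval 2 F).
Proof. exact: val_inj. Qed.

Lemma GL_norm_center (u : {'GL_2[F]}) : (u \in 'N('Z('GL_2[F])))%g.
Proof. by apply: (subsetP (gFnorm _ _)); rewrite inE. Qed.

Lemma PGL2_full : PGL2 F = [set: coset_of 'Z('GL_2[F])]%G.
Proof.
apply/val_inj/setP=> s; rewrite /= [RHS]inE.
by have [u Nu ->] := cosetP s; rewrite mem_quotient ?inE.
Qed.

Lemma pclassP s : exists2 A, A \in unitmx & s = pclass A.
Proof.
have [u Nu ->] := cosetP s; exists (GLval u); first by have := GL_unitmx u.
by rewrite /pclass /insubd valK.
Qed.

Lemma pclassM A B : A \in unitmx -> B \in unitmx ->
  (pclass A * pclass B)%g = pclass (A *m B).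
Proof.
move=> uA uB; rewrite /pclass -morphM ?GL_norm_center //; congr coset.
by apply: GLval_inj; rewrite GL_MxE !GLval_insubd ?unitmx_mul ?uA.
Qed.

Lemma unitmx_scalar k : k != 0 -> k%:M \in @unitmx F 2.
Proof. by move=> k0; rewrite unitmxE det_scalar unitfE expf_neq0. Qed.

Lemma scalar_center k : k != 0 ->
  insubd (1%g : {'GL_2[F]}) (k%:M) \in ('Z('GL_2[F]))%g.
Proof.
move=> /unitmx_scalar uk.
apply/centerP; split=> [|u _]; first by rewrite inE.
by apply: GLval_inj; rewrite !GL_MxE GLval_insubd // scalar_mxC.
Qed.

Lemma pclass_eq A B : A \in unitmx -> B \in unitmx ->
  pclass A = pclass B <-> exists2 k, k != 0 & A = k *: B.
Proof.
move=> uA uB; split.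
  move/rcoset_kercosetP => /(_ (GL_norm_center _) (GL_norm_center _)).
  case/rcosetP=> z /center_GL2[k k0 zE] /(congr1 (@GLval 2 F)).
  by rewrite GL_MxE zE !GLval_insubd // mul_scalar_mx => ->; exists k.
case=> k k0 ->; have uk := unitmx_scalar k0.
apply/rcoset_kercosetP; rewrite ?GL_norm_center //.
apply/rcosetP; exists (insubd (1%g : {'GL_2[F]}) (k%:M)).
  exact: scalar_center.
apply: GLval_inj; rewrite GL_MxE -mul_scalar_mx !GLval_insubd //.
by rewrite unitmx_mul uk.
Qed.

Lemma lft_pclass A : A \in unitmx -> lft (pclass A) = moebius A.
Proof. by move=> uA; rewrite /pclass lft_coset GLval_insubd. Qed.

Lemma pclass1 : pclass 1%:M = 1%g.
Proof.
rewrite -[RHS](morph1 (coset_morphism _)) /pclass; congr coset.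
by apply: GLval_inj; rewrite GLval_insubd ?unitmx1.
Qed.

Definition mx2 a b c d : 'M[F]_2 :=
  \matrix_(i, j) if i == 0 then (if j == 0 then a else b)
                 else (if j == 0 then c else d).

Lemma mx2E a b c d : (mx2 a b c d 0 0 = a) * (mx2 a b c d 0 1 = b)
  * (mx2 a b c d 1 0 = c) * (mx2 a b c d 1 1 = d).
Proof. by rewrite !mxE. Qed.

Lemma ord2P (i : 'I_2) : i = 0 \/ i = 1.
Proof. by case: i => [[|[|i]]] // ?; [left|right]; apply/val_inj. Qed.

Lemma mx2_eta A : A = mx2 (A 0 0) (A 0 1) (A 1 0) (A 1 1).
Proof.
by apply/matrixP=> i j; case: (ord2P i) => ->; case: (ord2P j) => ->; rewrite mx2E.
Qed.

Lemma mx2_inj a b c d a' b' c' d' : mx2 a b c d = mx2 a' b' c' d' ->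
  [/\ a = a', b = b', c = c' & d = d'].
Proof.
move=> /matrixP E.
by split; [move: (E 0 0) | move: (E 0 1) | move: (E 1 0) | move: (E 1 1)];
  rewrite !mx2E.
Qed.

Lemma mx2M a b c d a' b' c' d' : mx2 a b c d *m mx2 a' b' c' d' =
  mx2 (a * a' + b * c') (a * b' + b * d') (c * a' + d * c') (c * b' + d * d').
Proof.
by rewrite [LHS]mx2_eta; congr mx2; rewrite !mxE !big_ord_recl big_ord0 addr0 !mxE.
Qed.

Lemma mx2Z k a b c d : k *: mx2 a b c d = mx2 (k * a) (k * b) (k * c) (k * d).
Proof. by rewrite [LHS]mx2_eta; congr mx2; rewrite !mxE. Qed.

Lemma det_mx22 A : \det A = A 0 0 * A 1 1 - A 0 1 * A 1 0.
Proof.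
rewrite (expand_det_row _ 0) !big_ord_recl big_ord0 addr0 /cofactor !det_mx11.
rewrite !mxE /= expr0 expr1 mul1r mulN1r mulrN.
by congr (_ * _ - _ * _); congr (A _ _); apply: val_inj.
Qed.

Lemma mx2_unit a b c d : (mx2 a b c d \in unitmx) = (a * d - b * c != 0).
Proof. by rewrite unitmxE unitfE det_mx22 !mx2E. Qed.

Lemma mx2_1 : 1%:M = mx2 1 0 0 1.
Proof. by rewrite [LHS]mx2_eta !mxE. Qed.

Definition pgl a b c d := pclass (mx2 a b c d).

Lemma pglP s : exists a b c d, a * d - b * c != 0 /\ s = pgl a b c d.
Proof.
have [A uA ->] := pclassP s.
exists (A 0 0), (A 0 1), (A 1 0), (A 1 1).
by rewrite /pgl -mx2_eta -det_mx22 -unitfE -unitmxE.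
Qed.

Lemma pglM a b c d a' b' c' d' :
  a * d - b * c != 0 -> a' * d' - b' * c' != 0 ->
  (pgl a b c d * pgl a' b' c' d')%g =
  pgl (a * a' + b * c') (a * b' + b * d') (c * a' + d * c') (c * b' + d * d').
Proof. by move=> u u'; rewrite /pgl pclassM ?mx2_unit // mx2M. Qed.

Lemma pgl_eq a b c d a' b' c' d' :
  a * d - b * c != 0 -> a' * d' - b' * c' != 0 ->
  pgl a b c d = pgl a' b' c' d' <->
  exists k, [/\ k != 0, a = k * a', b = k * b', c = k * c' & d = k * d'].
Proof.
move=> u u'; rewrite pclass_eq ?mx2_unit //; split.
  by case=> k k0; rewrite mx2Z => /mx2_inj[*]; exists k.
by case=> k [k0 -> -> -> ->]; exists k; rewrite // mx2Z.
Qed.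

Lemma pgl1 : pgl 1 0 0 1 = 1%g.
Proof. by rewrite /pgl -mx2_1 pclass1. Qed.

End ProjectiveMatrices.

(** * The Frobenius and the prime field *)
Section FrobeniusPower.
Variables (p : nat) (F : fieldType).

(** Additivity holds only in characteristic [p]; with its proof inside the term,
the ring morphism structure is inferred from the term alone. *)
Definition frob of p \in [pchar F] := fun (j : nat) (x : F) => x ^+ (p ^ j).

Variable pF : p \in [pchar F].

Lemma frobE j x : frob pF j x = x ^+ (p ^ j).
Proof. by []. Qed.

Lemma frobS j x : frob pF j.+1 x = frob pF j x ^+ p.
Proof. by rewrite /frob expnSr exprM. Qed.

Lemma frob_zmod j : zmod_morphism (frob pF j).
Proof.
move=> x y; elim: j => [|j IHj]; first by rewrite /frob !expr1.
by rewrite !frobS IHj -!(pFrobenius_autE pF) rmorphB.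
Qed.

Lemma frob_monoid j : monoid_morphism (frob pF j).
Proof. by rewrite /frob; split=> [|x y]; rewrite ?expr1n ?exprMn. Qed.

HB.instance Definition _ j :=
  GRing.isZmodMorphism.Build F F (frob pF j) (frob_zmod j).
HB.instance Definition _ j :=
  GRing.isMonoidMorphism.Build F F (frob pF j) (frob_monoid j).

End FrobeniusPower.

Section PrimeField.
Variables (p : nat) (F : finFieldType).

(** The embedding [of_Fp] is a ring morphism in characteristic [p]; as for
[frob], the term carries the proof so that the structure can be inferred. *)
Definition ofFp of p \in [pchar F] := @of_Fp p F.

Variable pF : p \in [pchar F].
Let p_prime := GRing.pcharf_prime pF.

Lemma ofFp_nat k : ofFp pF k%:R = k%:R.
Proof.
rewrite /ofFp /of_Fp -[RHS](GRing.natr_mod_pchar pF).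
by congr _%:R; rewrite val_Fp_nat.
Qed.

Lemma Fp_natP (a : 'F_p) : exists k, a = k%:R.
Proof. by exists (val a); rewrite natr_Zp. Qed.

Lemma ofFp_zmod : zmod_morphism (ofFp pF).
Proof.
move=> x y; have [k ->] := Fp_natP x; have [l ->] := Fp_natP y.
have [m Em] := Fp_natP (k%:R - l%:R).
apply: (@addIr _ (ofFp pF l%:R)); rewrite subrK Em !ofFp_nat -natrD.
by rewrite -!ofFp_nat natrD -Em subrK.
Qed.

Lemma ofFp_monoid : monoid_morphism (ofFp pF).
Proof.
split=> [|x y]; first by have := ofFp_nat 1.
have [k ->] := Fp_natP x; have [l ->] := Fp_natP y.
by rewrite -natrM !ofFp_nat natrM.
Qed.

HB.instance Definition _ :=
  GRing.isZmodMorphism.Build _ _ (ofFp pF) ofFp_zmod.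
HB.instance Definition _ :=
  GRing.isMonoidMorphism.Build _ _ (ofFp pF) ofFp_monoid.

Lemma Fp_morph_eq (R : nzRingType) (e e' : {rmorphism 'F_p -> R}) : e =1 e'.
Proof. by move=> a; have [k ->] := Fp_natP a; rewrite !rmorph_nat. Qed.

(** The polynomial [X ^ p - X] already splits over the prime field. *)
Lemma frob_fixed (x : F) : x ^+ p = x -> exists a, x = ofFp pF a.
Proof.
move=> xp; have := congr1 (map_poly (ofFp pF)) (finField_genPoly 'F_p).
rewrite card_Fp // rmorphB /= map_polyXn map_polyX rmorph_prod.
move/(congr1 (horner^~ x)); rewrite /= !hornerE xp subrr horner_prod.
move/eqP; rewrite eq_sym prodf_seq_eq0 => /hasP[a _] /=.
by rewrite rmorphB /= map_polyX map_polyC !hornerE subr_eq0 => /eqP->; exists a.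
Qed.

Lemma frob_fixed_poly (h : {poly F}) :
  map_poly (frob pF 1) h = h -> exists h0, h = map_poly (ofFp pF) h0.
Proof.
move=> hE; suff [r Er]: exists r, h = map (ofFp pF) r :> seq F.
  exists (Poly r); apply/polyP=> k; rewrite coef_map coef_Poly Er.
  have [kr|rk] := ltnP k (size r); first by rewrite (nth_map 0).
  by rewrite !nth_default ?size_map // rmorph0.
have: all (fun x => x ^+ p == x) h.
  apply/(all_nthP 0) => k _; apply/eqP.
  by have := congr1 (fun g : {poly F} => g`_k) hE; rewrite coef_map /= /frob expn1.
elim: (polyseq h) => [|x s IHs]; first by exists nil.
case/andP=> /eqP/frob_fixed[a ->] /IHs[r ->].
by exists (a :: r).
Qed.

End PrimeField.

(** * Endomorphisms and embeddings of a finite field *)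
Section FiniteField.
Variables (p n : nat) (F : finFieldType) (pF : p \in [pchar F]).
Hypothesis cardF : #|F| = (p ^ n)%N.
Let p_prime := GRing.pcharf_prime pF.

Lemma field_degree_gt0 : (0 < n)%N.
Proof.
by have := card_finRing_gt1 F; rewrite cardF; case: n; rewrite ?expn0.
Qed.

Lemma finField_powers : exists w : F, forall x : F, x != 0 -> exists k, x = w ^+ k.
Proof.
have /cyclicP[u Eu] := field_unit_group_cyclic [set: {unit F}].
exists (val u) => x x0; have ux : x \is a GRing.unit by rewrite unitfE.
have: FinRing.unit F ux \in <[u]>%g by rewrite -Eu inE.
by case/cycleP=> k /(congr1 val) /= ->; exists k; rewrite FinRing.val_unitX.
Qed.

Variable w : F.
Hypothesis wgen : forall x : F, x != 0 -> exists k, x = w ^+ k.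

(** If two of the [n] conjugates of the generator [w] agreed, then
[X ^ (p ^ k) - X] with [0 < k < n] would vanish on all [p ^ n] elements. *)
Lemma frob_gen_inj : {in [pred j | j < n]%N &, injective (fun j => frob pF j w)}.
Proof.
have wlt i j : (i < j < n)%N -> frob pF i w != frob pF j w.
  case/andP=> ij jn; apply/eqP=> E.
  have Ex (x : F) : x ^+ (p ^ (j - i)) = x.
    have [->|x0] := eqVneq x 0; last have [k ->] := wgen x0.
      by rewrite expr0n expn_eq0 -leqn0 leqNgt (prime_gt0 p_prime).
    apply: (fmorph_inj (frob pF i)).
    rewrite /= !frobE -!exprM -mulnA -expnD subnK 1?ltnW // ![(k * _)%N]mulnC !exprM.
    by move: E; rewrite !frobE => <-.
  have p1 := prime_gt1 p_prime; pose m := (p ^ (j - i))%N.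
  have m1 : (1 < m)%N by rewrite -(expn0 p) ltn_exp2l ?subn_gt0.
  have sP : size ('X^m - 'X : {poly F}) = m.+1.
    by rewrite size_polyDl size_polyXn // size_polyN size_polyX ltnS.
  have P0 : 'X^m - 'X != 0 :> {poly F} by rewrite -size_poly_eq0 sP.
  have rP : all (root ('X^m - 'X)) (enum F).
    by apply/allP=> x _; rewrite rootE !hornerE Ex subrr.
  have := max_poly_roots P0 rP (enum_uniq F).
  by rewrite sP -cardE cardF ltnS leq_exp2l // leqNgt (leq_ltn_trans (leq_subr _ _) jn).
move=> i j; rewrite !inE => ni nj E.
case: (ltngtP i j) => // ij; [have := wlt i j | have := wlt j i].
  by rewrite ij nj E eqxx => /(_ isT).
by rewrite ij ni E eqxx => /(_ isT).
Qed.

(** The Frobenius permutes the conjugates of [w] cyclically, because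
[w ^+ q = w]; so it fixes the coefficients of the product. *)
Lemma exists_conjugates_poly : exists m0 : {poly 'F_p},
  map_poly (ofFp pF) m0 = \prod_(j < n) ('X - (frob pF j w)%:P).
Proof.
have [|m0 ->] := @frob_fixed_poly p F pF (\prod_(j < n) ('X - (frob pF j w)%:P)).
  rewrite rmorph_prod /=.
  under eq_bigr do rewrite rmorphB /= map_polyX map_polyC /= /frob -exprM -expnSr.
  have [m En] : exists m, n = m.+1 by exists n.-1; rewrite prednK ?field_degree_gt0.
  have Ew : w ^+ (p ^ m.+1) = w by rewrite -En -cardF expf_card.
  rewrite En big_ord_recr [RHS]big_ord_recl /= Ew mulrC /frob expn0 expr1.
  by congr (_ * _).
by exists m0.
Qed.

Variable m0 : {poly 'F_p}.
Hypothesis m0E : map_poly (ofFp pF) m0 = \prod_(j < n) ('X - (frob pF j w)%:P).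

(** The coefficients of [m0] are fixed by every endomorphism, so the image of
[w] is again a root. *)
Lemma endo_frob (s : {rmorphism F -> F}) : exists j : 'I_n, s w = frob pF j w.
Proof.
have: root (map_poly (ofFp pF) m0) (s w).
  have -> : map_poly (ofFp pF) m0 = map_poly s (map_poly (ofFp pF) m0).
    rewrite -map_poly_comp; apply: eq_map_poly => a /=.
    by rewrite -[RHS]/((s \o ofFp pF) a); apply: Fp_morph_eq.
  apply: rmorph_root; rewrite m0E -(big_mkord xpredT (fun j => 'X - (frob pF j w)%:P)).
  by rewrite big_ltn ?field_degree_gt0 // rootM root_XsubC /frob expr1 eqxx.
rewrite m0E rootE horner_prod prodf_seq_eq0 => /hasP[j _].
by rewrite !hornerE subr_eq0 => /eqP->; exists j.
Qed.

(** A polynomial over the prime field vanishes at all conjugates of [w] as soon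
as it vanishes at [w]. *)
Lemma conjugates_poly_min (h : {poly 'F_p}) : root (map_poly (ofFp pF) h) w -> m0 %| h.
Proof.
move=> hw; rewrite -(dvdp_map (ofFp pF)) m0E.
rewrite -(big_mkord xpredT (fun j => 'X - (frob pF j w)%:P)).
rewrite -(big_map _ xpredT (fun x => 'X - x%:P)).
apply: uniq_roots_dvdp.
  rewrite all_map; apply/allP=> j _ /=.
  have -> : map_poly (ofFp pF) h = map_poly (frob pF j) (map_poly (ofFp pF) h).
    rewrite -map_poly_comp; apply: eq_map_poly => a /=.
    by rewrite -[RHS]/((frob pF j \o ofFp pF) a); apply: Fp_morph_eq.
  exact: rmorph_root.
rewrite uniq_rootsE map_inj_in_uniq ?iota_uniq // => i j.
by rewrite !mem_index_iota => ni nj; apply: frob_gen_inj.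
Qed.

Lemma size_conjugates_poly : size m0 = n.+1.
Proof.
rewrite -(size_map_poly (ofFp pF)) m0E.
rewrite -(big_mkord xpredT (fun j => 'X - (frob pF j w)%:P)).
by rewrite size_prod_XsubC size_iota subn0.
Qed.

(** Every element of [F] is [h(w)] for some [h] over the prime field, and
[h(w) |-> h(b)] is well defined because [m0] divides every [h] that vanishes at
[w]. *)
Lemma finField_embedding (E : fieldType) (e : {rmorphism 'F_p -> E}) (b : E) :
  root (map_poly e m0) b -> inhabited {rmorphism F -> E}.
Proof.
move=> m0b.
have gP (x : F) : exists h, (map_poly (ofFp pF) h).[w] == x.
  have [->|x0] := eqVneq x 0; first by exists 0; rewrite map_poly0 horner0.
  by have [k ->] := wgen x0; exists 'X^k; rewrite map_polyXn hornerXn.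
pose g x := xchoose (gP x).
have gE x : (map_poly (ofFp pF) (g x)).[w] = x by apply/eqP/(xchooseP (gP x)).
have transfer h h' : (map_poly (ofFp pF) h).[w] = (map_poly (ofFp pF) h').[w] ->
    (map_poly e h).[b] = (map_poly e h').[b].
  move=> Ehh'; apply/eqP; rewrite -subr_eq0 -hornerN -hornerD -rmorphB /=.
  have /conjugates_poly_min : root (map_poly (ofFp pF) (h - h')) w.
    by rewrite rootE rmorphB hornerD hornerN Ehh' subrr.
  rewrite -(dvdp_map e) => /dvdpP[q ->].
  by rewrite hornerM (rootP m0b) mulr0.
pose io x := (map_poly e (g x)).[b].
have io_z : zmod_morphism io.
  move=> x y; rewrite /io -hornerN -hornerD -rmorphB; apply: transfer.
  by rewrite gE rmorphB hornerD hornerN !gE.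
have io_m : monoid_morphism io.
  split=> [|x y]; last first.
    by rewrite /io -hornerM -rmorphM; apply: transfer; rewrite gE rmorphM hornerM !gE.
  by rewrite /io (transfer (g 1) 1) ?rmorph1 ?hornerC // gE.
exact: inhabits (HB.pack_for {rmorphism F -> E} io
  (GRing.isZmodMorphism.Build F E io io_z)
  (GRing.isMonoidMorphism.Build F E io io_m)).
Qed.

End FiniteField.

(** * Generators of PGL(2) and automorphisms fixing a flag *)
Section Generators.
Variable F : finFieldType.
Implicit Types (a b c d k y : F).

Definition upper y := pgl 1 y 0 1.
Definition lower y := pgl 1 0 y 1.
Definition diagonal y := pgl y 0 0 1.
Arguments upper y%_R.
Arguments lower y%_R.
Arguments diagonal y%_R.
Arguments pgl {F} (a b c d)%_R.

Lemma eq_pgl a b c d a' b' c' d' : a = a' -> b = b' -> c = c' -> d = d' ->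
  pgl a b c d = pgl a' b' c' d'.
Proof. by move=> -> -> -> ->. Qed.

Lemma upper_det y : 1 * 1 - y * 0 != 0 :> F.
Proof. by rewrite mulr1 mulr0 subr0 oner_neq0. Qed.

Lemma lower_det y : 1 * 1 - 0 * y != 0 :> F.
Proof. by rewrite mulr1 mul0r subr0 oner_neq0. Qed.

Lemma diagonal_det y : y != 0 -> y * 1 - 0 * 0 != 0 :> F.
Proof. by rewrite mulr1 mulr0 subr0. Qed.

Hint Resolve upper_det lower_det diagonal_det : core.

Lemma mul_upper a b c d y : a * d - b * c != 0 ->
  (pgl a b c d * upper y)%g = pgl a (a * y + b) c (c * y + d).
Proof. by move=> D; rewrite pglM //; apply: eq_pgl; ring. Qed.

Lemma upper_mul a b c d y : a * d - b * c != 0 ->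
  (upper y * pgl a b c d)%g = pgl (a + y * c) (b + y * d) c d.
Proof. by move=> D; rewrite pglM //; apply: eq_pgl; ring. Qed.

Lemma mul_lower a b c d y : a * d - b * c != 0 ->
  (pgl a b c d * lower y)%g = pgl (a + b * y) b (c + d * y) d.
Proof. by move=> D; rewrite pglM //; apply: eq_pgl; ring. Qed.

Lemma lower_mul a b c d y : a * d - b * c != 0 ->
  (lower y * pgl a b c d)%g = pgl a b (y * a + c) (y * b + d).
Proof. by move=> D; rewrite pglM //; apply: eq_pgl; ring. Qed.

Lemma mul_diagonal a b c d y : a * d - b * c != 0 -> y != 0 ->
  (pgl a b c d * diagonal y)%g = pgl (a * y) b (c * y) d.
Proof. by move=> D y0; rewrite pglM ?diagonal_det //; apply: eq_pgl; ring. Qed.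

Lemma upper0 : upper 0 = 1%g. Proof. exact: pgl1. Qed.
Lemma lower0 : lower 0 = 1%g. Proof. exact: pgl1. Qed.

Lemma upperM y z : (upper y * upper z = upper (y + z))%g.
Proof. by rewrite upper_mul //; apply: eq_pgl; ring. Qed.

Lemma lowerM y z : (lower y * lower z = lower (y + z))%g.
Proof. by rewrite lower_mul //; apply: eq_pgl; ring. Qed.

Lemma upper_inj : injective upper.
Proof.
move=> y z /pgl_eq[] // k [_ ]; by rewrite mulr1 => <-; rewrite mul1r => ->.
Qed.

Lemma lower_inj : injective lower.
Proof.
move=> y z /pgl_eq[] // k [_ ]; by rewrite mulr1 => <- _; rewrite mul1r => ->.
Qed.

Lemma diagonal_upper a y : a != 0 ->
  (diagonal a * upper y = upper (a * y) * diagonal a)%g.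
Proof.
by move=> a0; rewrite mul_upper ?diagonal_det // mul_diagonal //; apply: eq_pgl; ring.
Qed.

Lemma diagonal_lower a y : a != 0 ->
  (diagonal a * lower y = lower (y / a) * diagonal a)%g.
Proof.
by move=> a0; rewrite mul_lower ?diagonal_det // mul_diagonal //; apply: eq_pgl; field.
Qed.

(** The element [upper 1 * lower (- 1) * upper 1] represents the Weyl element,
which exchanges the two unipotent groups.  This one relation between them is
what fixes their relative scale in [flag_automorphism]. *)
Lemma braid :
  (upper 1 * lower (- 1) * upper 1 * upper 1 =
   lower (- 1) * (upper 1 * lower (- 1) * upper 1))%g.
Proof.
have D : (0 : F) * 0 - 1 * (- 1) != 0 by rewrite mul0r mul1r sub0r opprK oner_neq0.
have -> : (upper 1 * lower (- 1) * upper 1)%g = pgl 0 1 (- 1) 0.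
  rewrite upper_mul // mul_upper; first by apply: eq_pgl; ring.
  by apply: contra_neq (oner_neq0 F) => <-; ring.
by rewrite mul_upper // lower_mul //; apply: eq_pgl; ring.
Qed.

Lemma big_cell a b c d : a * d - b * c != 0 -> d != 0 ->
  exists y e z, e != 0 /\ pgl a b c d = (upper y * diagonal e * lower z)%g.
Proof.
move=> D d0; exists (b / d), ((a * d - b * c) / d ^+ 2), (c / d).
have e0 : (a * d - b * c) / d ^+ 2 != 0.
  by rewrite mulf_neq0 // invr_eq0 expf_eq0.
split=> //; rewrite upper_mul ?diagonal_det // mul_lower; last first.
  by apply: contra_neq e0 => <-; ring.
apply/pgl_eq => //; first by apply: contra_neq e0 => <-; ring.
by exists d; split=> //; field.
Qed.

(** An element outside the big cell [d != 0] is moved into it by [upper 1]. *)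
Lemma PGL2_generated (gT : finGroupType) (f f' : coset_of 'Z('GL_2[F]) -> gT) :
    {morph f : x y / (x * y)%g} -> {morph f' : x y / (x * y)%g} ->
    (forall y, f (upper y) = f' (upper y)) -> (forall y, f (lower y) = f' (lower y)) ->
    (forall e : F, e != 0 -> f (diagonal e) = f' (diagonal e)) ->
  f =1 f'.
Proof.
move=> fM f'M fu fl fd.
have cell a b c d : a * d - b * c != 0 -> d != 0 -> f (pgl a b c d) = f' (pgl a b c d).
  move=> D d0; have [y [e [z [e0 ->]]]] := big_cell D d0.
  by rewrite !fM !f'M fu fl fd.
move=> s; have [a [b [c [d [D ->]]]]] := pglP s.
have [d0|] := eqVneq d 0; last exact: cell.
have c0 : c != 0 by apply: contra_neq D => ->; rewrite d0; ring.
have -> : pgl a b c d = (pgl a b c d * upper 1 * upper (- 1))%g.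
  by rewrite -mulgA (upperM 1) subrr upper0 mulg1.
rewrite fM f'M fu mul_upper // cell //; last by rewrite d0 mulr1 addr0.
by apply: contra_neq D => <-; ring.
Qed.

(** The action of [f] on [upper] is an additive map [s].  Diagonal elements are
those that normalise both unipotent groups, so [f] preserves them; they act on
[upper] by multiplication, which makes [s] multiplicative.  On [lower] they act
by division, so [f] acts there as a multiple of [s], and the braid relation
shows that the factor is 1. *)
Lemma flag_automorphism (f : coset_of 'Z('GL_2[F]) -> coset_of 'Z('GL_2[F])) :
    {morph f : x y / (x * y)%g} -> injective f -> f (upper 1) = upper 1 ->
    (forall y, exists z, f (upper y) = upper z) ->
    (forall y, exists z, f (lower y) = lower z) ->
  exists s : {rmorphism F -> F},
    [/\ forall y, f (upper y) = upper (s y), forall y, f (lower y) = lower (s y)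
      & forall e : F, e != 0 -> f (diagonal e) = diagonal (s e)].
Proof.
move=> fM f_inj f1 /fin_all_exists[s fu] /fin_all_exists[t fl].
have sD : {morph s : y z / y + z}.
  by move=> y z; apply: upper_inj; rewrite -upperM -!fu -fM upperM.
have tD : {morph t : y z / y + z}.
  by move=> y z; apply: lower_inj; rewrite -lowerM -!fl -fM lowerM.
have s0 : s 0 = 0 by apply: (addrI (s 0)); rewrite -sD !addr0.
have t0 : t 0 = 0 by apply: (addrI (t 0)); rewrite -tD !addr0.
have s_inj : injective s by move=> y z E; apply/upper_inj/f_inj; rewrite !fu E.
have t_inj : injective t by move=> y z E; apply/lower_inj/f_inj; rewrite !fl E.
have s1 : s 1 = 1 by apply: upper_inj; rewrite -fu.
have sn0 y : y != 0 -> s y != 0 by rewrite -{2}s0 (inj_eq s_inj).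
have t1n0 : t 1 != 0 by rewrite -t0 (inj_eq t_inj) oner_neq0.
have fdu e y : e != 0 ->
    (f (diagonal e) * upper (s y) = upper (s (e * y)%R) * f (diagonal e))%g.
  by move=> e0; rewrite -!fu -!fM diagonal_upper.
have fdl e y : e != 0 ->
    (f (diagonal e) * lower (t y) = lower (t (y / e)%R) * f (diagonal e))%g.
  by move=> e0; rewrite -!fl -!fM diagonal_lower.
(* Conjugation of [upper 1] gives [c = 0], conjugation of [lower 1] gives [b = 0]. *)
have fd (e : F) : e != 0 -> f (diagonal e) = diagonal (s e).
  move=> e0; have [a [b [c [d [D fe]]]]] := pglP (f (diagonal e)).
  have := fdu e 1 e0; rewrite s1 mulr1 fe (mul_upper _ D) (upper_mul _ D).
  case/pgl_eq=> [||k [k0 Ea Eb Ec Ed]]; try by apply: contra_neq D => <-; ring.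
  have c0 : c = 0.
    apply/eqP; apply: contraTT isT => c0.
    have k1 : k = 1 by apply: (mulIf c0); rewrite mul1r -Ec.
    move: Ed c0; rewrite k1 mul1r mulr1 => /(canRL (addrK _)).
    by rewrite subrr => ->; rewrite eqxx.
  have d0 : d != 0 by apply: contra_neq D => ->; rewrite c0; ring.
  have k1 : k = 1 by apply: (mulIf d0); rewrite -Ed c0; ring.
  have aE : a = s e * d.
    by move: Eb; rewrite k1 mul1r mulr1 addrC => /addrI.
  have := fdl e 1 e0; rewrite fe (mul_lower _ D) (lower_mul _ D).
  case/pgl_eq=> [||m [m0 Fa Fb Fc Fd]]; try by apply: contra_neq D => <-; ring.
  have b0 : b = 0.
    apply/eqP; apply: contraTT isT => b0.
    have m1 : m = 1 by apply: (mulIf b0); rewrite mul1r -Fb.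
    move: Fa; rewrite m1 mul1r => /(canRL (addKr _)); rewrite addNr => /eqP.
    by rewrite mulf_eq0 (negPf b0) (negPf t1n0).
  apply/pgl_eq; rewrite ?diagonal_det ?sn0 //.
  by exists d; rewrite aE b0 c0 !mulr0 mulr1 [d * _]mulrC.
have sM : {morph s : y z / y * z}.
  move=> y z; have [->|y0] := eqVneq y 0; first by rewrite mul0r s0 mul0r.
  have := fdu y z y0; rewrite fd // diagonal_upper ?sn0 //.
  by move/mulIg/upper_inj.
have tE y : t y = t 1 * s y.
  have [->|y0] := eqVneq y 0; first by rewrite s0 t0 mulr0.
  have yV0 : y^-1 != 0 by rewrite invr_eq0.
  have := fdl _ 1 yV0; rewrite fd // diagonal_lower ?sn0 //.
  move/mulIg/lower_inj; rewrite mul1r invrK => <-; congr (_ * _).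
  by apply: (mulIf (sn0 _ yV0)); rewrite mulVf ?sn0 // -sM mulfV.
have sN y : s (- y) = - s y by apply: (addrI (s y)); rewrite -sD !subrr s0.
have t1 : t 1 = 1.
  have := congr1 f braid; rewrite !fM !f1 !fl tE sN s1 mulrN1; set c := t 1.
  have -> : (upper 1 * lower (- c) * upper 1)%g = pgl (1 - c) (1 + 1 - c) (- c) (1 - c).
    rewrite upper_mul // mul_upper; first by apply: eq_pgl; ring.
    by apply: contra_neq (oner_neq0 F) => <-; ring.
  have D : (1 - c) * (1 - c) - (1 + 1 - c) * (- c) != 0.
    by apply: contra_neq (oner_neq0 F) => <-; ring.
  rewrite (mul_upper _ D) (lower_mul _ D) => /pgl_eq[||k [k0 Ea Eb _ _]].
  - by apply: contra_neq D => <-; ring.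
  - by apply: contra_neq D => <-; ring.
  apply/eqP; apply: contraTT isT => c1; have c1' : 1 - c != 0 by rewrite subr_eq0 eq_sym.
  have k1 : k = 1 by apply: (mulIf c1'); rewrite mul1r -Ea.
  move: Eb; rewrite k1 mul1r mulr1 => /(canRL (addrK _)) /eqP.
  by rewrite subrr (negPf c1').
have s_z : zmod_morphism s by move=> y z; rewrite sD sN.
have s_m : monoid_morphism s by [].
exists (HB.pack_for {rmorphism F -> F} s
  (GRing.isZmodMorphism.Build F F s s_z)
  (GRing.isMonoidMorphism.Build F F s s_m)).
by split=> //= y; rewrite fl tE t1 mul1r.
Qed.

End Generators.
Arguments upper {F} y%_R.
Arguments lower {F} y%_R.
Arguments diagonal {F} y%_R.
Arguments pgl {F} (a b c d)%_R.

(** * The order of the automorphism group of PGL(2) *)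
Section AutBound.
Variables (p n : nat) (F : finFieldType) (pF : p \in [pchar F]).
Hypothesis cardF : #|F| = (p ^ n)%N.
Local Notation gT := (coset_of 'Z('GL_2[F])).
Local Notation G := (PGL2 F).
Local Notation q := #|F|.
Let p_prime := GRing.pcharf_prime pF.

Lemma card_center_GL2 : #|'Z('GL_2[F])%g| = q.-1.
Proof.
have -> : 'Z('GL_2[F])%g = (fun k : F => insubd (1%g : {'GL_2[F]}) k%:M) @: [set~ 0].
  apply/setP=> z; apply/idP/imsetP=> [/center_GL2[k k0 zE]|[k]].
    exists k; rewrite ?inE //; apply: GLval_inj.
    by rewrite zE GLval_insubd // unitmx_scalar.
  by rewrite in_setC1 => k0 ->; exact: scalar_center.
rewrite card_in_imset ?cardsC1 // => k l; rewrite !inE => k0 l0 /(congr1 (@GLval 2 F)).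
rewrite !GLval_insubd ?unitmx_scalar // => /matrixP/(_ 0 0).
by rewrite !mxE !mulr1n.
Qed.

Lemma card_PGL2 : #|G| = (q * q.-1 * q.+1)%N.
Proof.
have q1 := card_finRing_gt1 F.
have q10 : (0 < q.-1)%N by rewrite -ltnS prednK // ltnW.
apply/eqP; rewrite -(eqn_pmul2l q10) -{1}card_center_GL2.
rewrite card_quotient ?gFnorm // Lagrange ?center_sub // card_GL_2.
by rewrite expnS expn1 !mulnA [(q * _)%N]mulnC.
Qed.

Definition uppers := [set @upper F y | y : F].
Definition lowers := [set @lower F y | y : F].

Lemma mem_uppers y : upper y \in uppers. Proof. exact: imset_f. Qed.
Lemma mem_lowers y : lower y \in lowers. Proof. exact: imset_f. Qed.

Lemma group_set_uppers : group_set uppers.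
Proof.
apply/group_setP; split; first by rewrite -upper0 imset_f.
by move=> _ _ /imsetP[y _ ->] /imsetP[z _ ->]; rewrite upperM imset_f.
Qed.
Canonical uppers_group := Group group_set_uppers.

Lemma group_set_lowers : group_set lowers.
Proof.
apply/group_setP; split; first by rewrite -lower0 imset_f.
by move=> _ _ /imsetP[y _ ->] /imsetP[z _ ->]; rewrite lowerM imset_f.
Qed.
Canonical lowers_group := Group group_set_lowers.

Lemma card_uppers : #|uppers| = q. Proof. by rewrite card_imset //; exact: upper_inj. Qed.
Lemma card_lowers : #|lowers| = q. Proof. by rewrite card_imset //; exact: lower_inj. Qed.

Lemma subPGL2 (A : {set gT}) : A \subset G.
Proof. by rewrite PGL2_full subsetT. Qed.

Lemma memPGL2 (s : gT) : s \in G.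
Proof. by rewrite PGL2_full inE. Qed.

(** The index is [q ^ 2 - 1], which is prime to [p]. *)
Lemma Sylow_PGL2 (A : {group gT}) : #|A| = q -> p.-Sylow(G)%g A.
Proof.
move=> cA; have q1 := card_finRing_gt1 F.
have q0 : (0 < q)%N by rewrite ltnW.
have n0 := field_degree_gt0 cardF.
have pq : (p %| q)%N by rewrite cardF dvdn_exp.
have -> : p.-Sylow(G)%g A = (p.-nat #|A| && p^'.-nat #|G : A|%g).
  by rewrite /pHall subPGL2.
rewrite cA {1}cardF pnatX pnat_id //=.
have -> : #|G : A|%g = (q.-1 * q.+1)%N.
  apply/eqP; rewrite -(eqn_pmul2l q0) -{1}cA Lagrange ?subPGL2 //.
  by rewrite card_PGL2 mulnA.
rewrite p'natE // Euclid_dvdM // -{1}subn1 -(addn1 q) negb_or; apply/andP; split.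
  apply: contraL pq => pq1; rewrite -(subnK q0) dvdn_addr // dvdn1.
  by rewrite gtn_eqF ?prime_gt1.
by rewrite dvdn_addr // dvdn1 gtn_eqF ?prime_gt1.
Qed.

(** The normaliser contains the [q * (q - 1)] triangular elements. *)
Lemma card_conj_uppers : (#|(uppers :^: G)%g| <= q.+1)%N.
Proof.
have q1 := card_finRing_gt1 F.
have q10 : (0 < q.-1)%N by rewrite -ltnS prednK // ltnW.
have q0 : (0 < q)%N by rewrite ltnW.
rewrite card_conjugates.
pose f (x : F * F) := (upper x.1 * diagonal x.2)%g.
pose D := setX [set: F] [set~ (0 : F)].
have fN : f @: D \subset 'N_G(uppers)%g.
  apply/subsetP=> _ /imsetP[[y e] + ->]; rewrite in_setX in_setC1 /f /= => /andP[_ e0].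
  rewrite inE memPGL2 groupM //.
    by rewrite (subsetP (normG uppers_group)) ?imset_f.
  rewrite inE.
  apply/subsetP=> _ /imsetP[_ /imsetP[z _ ->] ->].
  apply/imsetP; exists (z / e) => //; rewrite conjgE.
  by apply: (canLR (mulKg _)); rewrite (diagonal_upper _ e0) mulrC divfK.
have cD : #|f @: D| = (q * q.-1)%N.
  rewrite card_in_imset ?cardsX ?cardsT ?cardsC1 // => -[y e] [z d].
  rewrite !inE /f /= => e0 d0; rewrite !mul_diagonal ?upper_det //.
  case/pgl_eq=> [||k [_ Ee Ey _ Ek]].
  - by rewrite mulr1 mul1r mul0r mulr0 subr0.
  - by rewrite mulr1 mul1r mul0r mulr0 subr0.
  by move: Ek Ee Ey; rewrite mulr1 => <-; rewrite !mul1r => -> ->.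
have := Lagrange (subsetIl G 'N(uppers)%g) => L.
have N0 : (q * q.-1 <= #|'N_G(uppers)%g|)%N by rewrite -cD subset_leq_card.
have := leq_mul N0 (leqnn #|G : 'N_G(uppers)|%g).
by rewrite L card_PGL2 leq_pmul2l // muln_gt0 q0.
Qed.

Lemma Aut_PGL2M (al : {perm gT}) : al \in Aut G -> {morph al : x y / (x * y)%g}.
Proof. by move=> /Aut_morphic/morphicP alM x y; rewrite alM ?memPGL2. Qed.

(** Subgroups of order [q] are Sylow subgroups, so they are all conjugate. *)
Lemma Aut_PGL2_Sylow (al : {perm gT}) (A : {group gT}) :
  al \in Aut G -> #|A| = q -> al @: A \in (uppers :^: G)%g.
Proof.
move=> alA cA.
have -> : al @: A = (autm alA @* A)%g by rewrite morphimEsub ?subPGL2.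
have cB : #|(autm alA @* A)%g| = q by rewrite card_injm ?injm_autm ?subPGL2.
have [x xG ->] := Sylow_trans (Sylow_PGL2 card_uppers) (Sylow_PGL2 cB).
exact: imset_f.
Qed.

Lemma uppers_neq_lowers : uppers != lowers.
Proof.
apply/eqP=> E; have: upper 1 \in lowers by rewrite -E mem_uppers.
case/imsetP=> y _ /pgl_eq[||k [_ E1 E2 _ _]].
- exact: upper_det.
- exact: lower_det.
by move: E2; rewrite mulr0 => /eqP; rewrite oner_eq0.
Qed.

(** The field endomorphism attached to such an automorphism determines it, and
is itself determined by the image of the generator [w], which is one of the [n]
Frobenius conjugates of [w]. *)
Lemma card_flag_stabiliser (A : {set {perm gT}}) :
    (forall al, al \in A -> [/\ al \in Aut G, al @: uppers = uppers,
       al @: lowers = lowers & al (upper 1) = upper 1]) ->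
  (#|A| <= n)%N.
Proof.
move=> AP; have [w wgen] := finField_powers F.
have [m0 m0E] := exists_conjugates_poly pF cardF w.
have endP al : al \in A -> exists s : {rmorphism F -> F},
    [/\ forall y, al (upper y) = upper (s y), forall y, al (lower y) = lower (s y)
      & forall e : F, e != 0 -> al (diagonal e) = diagonal (s e)].
  case/AP=> alG alU alL al1; apply: flag_automorphism => //.
  - exact: Aut_PGL2M.
  - exact: perm_inj.
  - move=> y; have: al (upper y) \in uppers by rewrite -alU imset_f ?mem_uppers.
    by case/imsetP=> z _ ->; exists z.
  - move=> y; have: al (lower y) \in lowers by rewrite -alL imset_f ?mem_lowers.
    by case/imsetP=> z _ ->; exists z.
have inj_al : {in A &, injective (fun al : {perm gT} => al (upper w))}.
  move=> al be alA beA; have [s [su sl sd]] := endP _ alA.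
  have [t [tu tl td]] := endP _ beA; rewrite su tu => /upper_inj st.
  have {}st y : s y = t y.
    have [->|y0] := eqVneq y 0; first by rewrite !rmorph0.
    by have [k ->] := wgen _ y0; rewrite !rmorphXn /= st.
  have [alG _ _ _] := AP _ alA; have [beG _ _ _] := AP _ beA.
  apply/permP; apply: (PGL2_generated (Aut_PGL2M alG) (Aut_PGL2M beG)).
  - by move=> y; rewrite su tu st.
  - by move=> y; rewrite sl tl st.
  - by move=> e e0; rewrite sd ?td ?st.
rewrite -(card_in_imset inj_al) -[n in (_ <= n)%N]card_ord.
apply: leq_trans (leq_imset_card (fun j : 'I_n => upper (frob pF j w)) _).
apply/subset_leq_card/subsetP=> _ /imsetP[al alA ->].
have [s [-> _ _]] := endP _ alA.
by have [j ->] := endo_frob cardF m0E s; apply/imsetP; exists j.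
Qed.

(** Three successive stabilisers: of the upper unipotent group ([q + 1]
conjugates), of the lower one ([q] remaining conjugates), and of the element
[upper 1] ([q - 1] nontrivial elements). *)
Lemma card_Aut_PGL2 : (#|Aut G| <= n * #|G|)%N.
Proof.
pose A := Aut G; pose A1 := 'C_A[uppers | 'P^*]%G.
pose A2 := 'C_A1[lowers | 'P^*]%G; pose A3 := 'C_A2[upper 1%R | 'P]%G.
have actE (al : {perm gT}) (S : {set gT}) : ('P^*)%act S al = al @: S.
  by apply: eq_imset.
have A1P al : al \in A1 -> al \in A /\ al @: uppers = uppers.
  by case/setIP=> alA /astab1P; rewrite actE.
have A2P al : al \in A2 -> al \in A1 /\ al @: lowers = lowers.
  by case/setIP=> alA /astab1P; rewrite actE.
have A3P al : al \in A3 -> al \in A2 /\ al (upper 1) = upper 1.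
  by case/setIP=> alA /astab1P.
have cA3 : (#|A3| <= n)%N.
  apply: card_flag_stabiliser => al /A3P[/A2P[/A1P[alA alU] alL] al1].
  by split.
have c1 : (#|orbit 'P^* A uppers| <= q.+1)%N.
  apply: leq_trans card_conj_uppers.
  apply/subset_leq_card/subsetP => _ /orbitP[al alA <-].
  by rewrite actE; exact: (Aut_PGL2_Sylow (A := uppers_group) alA card_uppers).
have c2 : (#|orbit 'P^* A1 lowers| <= q)%N.
  have uU : uppers \in (uppers :^: G)%g by apply/imsetP; exists 1%g; rewrite ?conjsg1.
  have cD := cardsD1 uppers (uppers :^: G)%g; rewrite uU add1n in cD.
  have := card_conj_uppers; rewrite cD ltnS; apply: leq_trans.
  apply/subset_leq_card/subsetP => _ /orbitP[al /A1P[alA alU] <-].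
  rewrite actE !inE (Aut_PGL2_Sylow (A := lowers_group) alA card_lowers) andbT.
  by rewrite -{1}alU (inj_eq (imset_inj perm_inj)) eq_sym uppers_neq_lowers.
have c3 : (#|orbit 'P A2 (upper 1%R)| <= q.-1)%N.
  have c1q : #|uppers :\ 1%g| = q.-1.
    by have := cardsD1 1%g uppers; rewrite card_uppers -{1}upper0 mem_uppers add1n => ->.
  rewrite -c1q; apply/subset_leq_card/subsetP => _ /orbitP[al /A2P[/A1P[alA alU] _] <-].
  rewrite /= apermE !inE -alU imset_f ?mem_uppers // andbT.
  have <- : al 1%g = 1%g.
    by apply: (mulgI (al 1%g)); rewrite -(Aut_PGL2M alA) !mulg1.
  by rewrite (inj_eq perm_inj) -upper0 (inj_eq (@upper_inj F)) oner_neq0.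
rewrite -(card_orbit_stab ('P^*)%act A uppers) -(card_orbit_stab ('P^*)%act A1 lowers).
rewrite -(card_orbit_stab 'P%act A2 (upper 1%R)) card_PGL2.
have := leq_mul c1 (leq_mul c2 (leq_mul c3 cA3)).
by congr (_ <= _)%N; ring.
Qed.

End AutBound.

(** * Morphisms out of a field of fractions *)
Section FractionMorphisms.
Local Notation frepr := generic_quotient.repr.
Variables (R : idomainType).

Lemma frepr_div (x : {fraction R}) :
  tofrac (frepr x).1 / tofrac (frepr x).2 = x.
Proof.
rewrite -[RHS]generic_quotient.reprK; apply: (canLR (mulfK _)).
  by rewrite tofrac_eq0 denom_ratioP.
unlock tofrac; rewrite -[RHS]FracField.pi_mul.
apply/eqmodP; rewrite /= FracField.equivfE /FracField.mulf.
by rewrite !numden_Ratio ?oner_neq0 ?mulr1 ?mul1r ?denom_ratioP //.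
Qed.

Lemma fracP (x : {fraction R}) :
  exists a b, b != 0 /\ x = tofrac a / tofrac b.
Proof. by exists (frepr x).1, (frepr x).2; rewrite denom_ratioP frepr_div. Qed.

Variables (E : fieldType) (phi : {rmorphism R -> E}).

Lemma frac_morph_ext (f g : {rmorphism {fraction R} -> E}) :
  (forall a, f (tofrac a) = g (tofrac a)) -> f =1 g.
Proof. by move=> fg x; have [a [b [_ ->]]] := fracP x; rewrite !fmorph_div /= !fg. Qed.

(** Computed on the chosen representative of a fraction; the injectivity proof,
which makes the value independent of that choice, stays in the term so that the
ring morphism structure can be inferred. *)
Definition frac_lift of injective phi := fun x : {fraction R} =>
  phi (frepr x).1 / phi (frepr x).2.

Variable phi_inj : injective phi.

Lemma frac_liftE a b : b != 0 ->
  frac_lift phi_inj (tofrac a / tofrac b) = phi a / phi b.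
Proof.
move=> b0; have phi0 c : c != 0 -> phi c != 0 by rewrite -(rmorph0 phi) (inj_eq phi_inj).
move: (frepr_div (tofrac a / tofrac b)); rewrite /frac_lift.
case: (frepr _) => [[c d] /= d0] /eqP.
rewrite !eqr_div ?tofrac_eq0 // -!tofracM tofrac_eq => /eqP E1.
by apply/eqP; rewrite eqr_div ?phi0 // -!rmorphM E1.
Qed.

Lemma frac_lift_tofrac a : frac_lift phi_inj (tofrac a) = phi a.
Proof.
have := frac_liftE a (oner_neq0 R).
by rewrite rmorph1 divr1 rmorph1 divr1.
Qed.

Lemma frac_lift_zmod : zmod_morphism (frac_lift phi_inj).
Proof.
have phi0 c : c != 0 -> phi c != 0 by rewrite -(rmorph0 phi) (inj_eq phi_inj).
move=> x y; have [a [b [b0 ->]]] := fracP x; have [c [d [d0 ->]]] := fracP y.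
rewrite -mulNr -tofracN addf_div ?tofrac_eq0 // -!tofracM -tofracD.
rewrite !frac_liftE ?mulf_neq0 // -mulNr addf_div ?phi0 //.
by rewrite !(rmorphM, rmorphD, rmorphN).
Qed.

Lemma frac_lift_monoid : monoid_morphism (frac_lift phi_inj).
Proof.
split=> [|x y]; first by rewrite -(rmorph1 (@tofrac R)) frac_lift_tofrac rmorph1.
have [a [b [b0 ->]]] := fracP x; have [c [d [d0 ->]]] := fracP y.
by rewrite mulf_div -!tofracM !frac_liftE ?mulf_neq0 // !rmorphM mulf_div.
Qed.

HB.instance Definition _ :=
  GRing.isZmodMorphism.Build _ _ (frac_lift phi_inj) frac_lift_zmod.
HB.instance Definition _ :=
  GRing.isMonoidMorphism.Build _ _ (frac_lift phi_inj) frac_lift_monoid.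

End FractionMorphisms.

HB.instance Definition _ (K : fieldType) :=
  GRing.RMorphism.copy (@ratC K) (@tofrac {poly K} \o polyC).

Section RationalMaps.
Variable K : fieldType.
Local Notation KX := {fraction {poly K}}.

Lemma ratCX_horner (h : {poly K}) : (map_poly (@ratC K) h).[ratX K] = tofrac h.
Proof.
elim/poly_ind: h => [|h c IHh]; first by rewrite !rmorph0 horner0.
rewrite rmorphD rmorphM /= map_polyX map_polyC /= !hornerE IHh.
by rewrite rmorphD rmorphM.
Qed.

Lemma ratmorph_horner (E : fieldType) (f : {rmorphism KX -> E}) (h : {poly K}) :
  f (tofrac h) = (map_poly (f \o @ratC K) h).[f (ratX K)].
Proof. by rewrite -ratCX_horner -horner_map -map_poly_comp. Qed.

Lemma ratmorph_ext (E : fieldType) (f g : {rmorphism KX -> E}) :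
  (forall c, f (ratC c) = g (ratC c)) -> f (ratX K) = g (ratX K) -> f =1 g.
Proof.
move=> fgC fgX; apply: frac_morph_ext => h.
rewrite (ratmorph_horner f) (ratmorph_horner g) fgX.
by congr (_.[_]); apply: eq_map_poly.
Qed.

Lemma ratX_transcendental : ~ algebraicOver (@ratC K) (ratX K).
Proof. by case=> h h0; rewrite rootE ratCX_horner tofrac_eq0 (negPf h0). Qed.

Lemma integralC c : integralOver (@ratC K) (ratC c).
Proof.
exists ('X - c%:P); first exact: monicXsubC.
by rewrite rmorphB /= map_polyX map_polyC root_XsubC.
Qed.

(** Otherwise the leading coefficient of [g] exhibits [z] as a constant. *)
Lemma fiber_neq0 (z : KX) (f g : {poly K}) : (forall c, z <> ratC c) -> g != 0 ->
  map_poly (@ratC K) f - z *: map_poly (@ratC K) g != 0.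
Proof.
move=> zC g0; apply/eqP=> /(congr1 (fun u : {poly KX} => u`_(size g).-1)).
rewrite coefB coefZ !coef_map coef0 /= => /eqP; rewrite subr_eq0 => /eqP E1.
have lg : lead_coef g != 0 by rewrite lead_coef_eq0.
apply: (zC (f`_(size g).-1 / lead_coef g)).
by rewrite fmorph_div /= E1 mulfK // fmorph_eq0.
Qed.

(** For [z = f / g] the variable is a root of [f(T) - z g(T)]; if [z] were
algebraic over the constants, the variable would be algebraic as well. *)
Lemma nonconstant_transcendental (z : KX) :
  (forall c, z <> ratC c) -> ~ algebraicOver (@ratC K) z.
Proof.
move=> zC /integral_algebraic intz; apply: ratX_transcendental.
have [f [g [g0 zE]]] := fracP z; apply/integral_algebraic.
pose u := map_poly (@ratC K) f - z *: map_poly (@ratC K) g.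
have coefu i : u`_i = ratC f`_i - z * ratC g`_i by rewrite coefB coefZ !coef_map.
apply: (@integral_root _ _ _ u).
- exact: fiber_neq0.
- rewrite rootE hornerD hornerN hornerZ !ratCX_horner zE divfK ?subrr //.
  by rewrite tofrac_eq0.
- move=> _ /(nthP 0)[i _ <-]; rewrite coefu.
  apply: (integral_sub (integralC _)); exact: integral_mul intz (integralC _).
Qed.

Variables (E : fieldType) (io : {rmorphism K -> E}) (y : E).

Lemma algebraic_comp (K0 : fieldType) (e : {rmorphism K0 -> K}) :
  algebraicOver (io \o e) y -> algebraicOver io y.
Proof.
by case=> h h0; rewrite map_poly_comp; exists (map_poly e h); rewrite ?map_poly_eq0.
Qed.

Let io_comm : commr_rmorph io y. Proof. by move=> c; apply: mulrC. Qed.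

Lemma transcendental_inj : ~ algebraicOver io y -> injective (horner_morph io_comm).
Proof.
move=> tr h h' E1; apply/eqP; rewrite -subr_eq0; apply: contra_notT tr => hh'.
exists (h - h') => //; rewrite rootE rmorphB hornerD hornerN.
by move: E1; rewrite /horner_morph => ->; rewrite subrr.
Qed.

(** Evaluation at a transcendental [y] never kills a denominator. *)
Definition ratmap (tr : ~ algebraicOver io y) := frac_lift (transcendental_inj tr).

Variable tr : ~ algebraicOver io y.
HB.instance Definition _ := GRing.RMorphism.on (ratmap tr).

Lemma ratmap_tofrac h : ratmap tr (tofrac h) = (map_poly io h).[y].
Proof. exact: frac_lift_tofrac. Qed.

Lemma ratmapC c : ratmap tr (ratC c) = io c.
Proof. by rewrite ratmap_tofrac map_polyC hornerC. Qed.

Lemma ratmapX : ratmap tr (ratX K) = y.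
Proof. by rewrite ratmap_tofrac map_polyX hornerX. Qed.

End RationalMaps.

(** * Substitutions in the rational function field *)
Section Substitutions.
Variables (p : nat) (F : finFieldType) (pF : p \in [pchar F]).
Local Notation gT := (coset_of 'Z('GL_2[F])).
Local Notation KX := {fraction {poly F}}.
Local Notation X := (ratX F).
Implicit Types (a b c d k : F) (r s : gT).

Lemma lin_eq0 c d : ratC c * X + ratC d = 0 -> c = 0 /\ d = 0.
Proof.
rewrite -tofracM -tofracD => /eqP; rewrite tofrac_eq0 => /eqP E.
have := congr1 (fun h : {poly F} => h`_1) E.
have := congr1 (fun h : {poly F} => h`_0) E.
by rewrite !coefD !coefMX !coefC /= add0r addr0.
Qed.

Lemma lft_pgl a b c d : a * d - b * c != 0 ->
  lft (pgl a b c d) = (ratC a * X + ratC b) / (ratC c * X + ratC d).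
Proof. by move=> D; rewrite lft_pclass ?mx2_unit // /moebius !mx2E. Qed.

Lemma lin_neq0 a b c d : a * d - b * c != 0 -> ratC c * X + ratC d != 0.
Proof.
by move=> D; apply/eqP=> /lin_eq0[c0 d0]; move: D; rewrite c0 d0 !mulr0 subrr eqxx.
Qed.

Lemma lft1 : lft 1%g = X.
Proof.
by rewrite -pgl1 lft_pgl ?upper_det // !rmorph1 !rmorph0 mul1r addr0 mul0r add0r divr1.
Qed.

Lemma lft_nonconstant s c : lft s <> ratC c.
Proof.
have [a [b [a' [b' [D ->]]]]] := pglP s; rewrite lft_pgl // => E.
have E1 : ratC (a - c * a') * X + ratC (b - c * b') = 0.
  rewrite !rmorphB !rmorphM /=; have := lin_neq0 D; move: E => /[swap] D0.
  move/(canRL (divfK D0)) => E.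
  have -> (u v u' v' w : KX) :
      (u - w * u') * X + (v - w * v') = (u * X + v) - w * (u' * X + v') by ring.
  by rewrite E subrr.
have [/eqP + /eqP] := lin_eq0 E1; rewrite !subr_eq0 => /eqP aE /eqP bE.
by move: D; rewrite aE bE mulrAC subrr eqxx.
Qed.

Lemma lft_transcendental s j : ~ algebraicOver (@ratC F \o frob pF j) (lft s).
Proof.
move/algebraic_comp; apply: nonconstant_transcendental; exact: lft_nonconstant.
Qed.

(** The substitution [X |-> s(X)] combined with the [j]-th power of the
Frobenius on the coefficients. *)
Definition subst s j : KX -> KX := ratmap (@lft_transcendental s j).
HB.instance Definition _ s j := GRing.RMorphism.on (subst s j).

Lemma substC s j c : subst s j (ratC c) = ratC (frob pF j c).
Proof. exact: ratmapC. Qed.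

Lemma substX s j : subst s j X = lft s.
Proof. exact: ratmapX. Qed.

Lemma subst_tofrac s j h :
  subst s j (tofrac h) = (map_poly (@ratC F) (map_poly (frob pF j) h)).[lft s].
Proof. by rewrite -map_poly_comp; apply: ratmap_tofrac. Qed.

Lemma subst_lin s j a b : subst s j (ratC a * X + ratC b) =
  ratC (frob pF j a) * lft s + ratC (frob pF j b).
Proof. by rewrite rmorphD rmorphM /= !substC substX. Qed.

Lemma subst_lft s j a b c d : a * d - b * c != 0 ->
  subst s j (lft (pgl a b c d)) =
  lft (pgl (frob pF j a) (frob pF j b) (frob pF j c) (frob pF j d) * s)%g.
Proof.
move=> D; pose sg := frob pF j.
have D' : sg a * sg d - sg b * sg c != 0.
  by rewrite -!rmorphM -rmorphB fmorph_eq0.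
have [a' [b' [c' [d' [E ->]]]]] := pglP s.
rewrite pglM // !lft_pgl //; last first.
  by apply: contra_neq (mulf_neq0 D' E) => <-; ring.
have D0 := lin_neq0 E.
rewrite fmorph_div /= !subst_lin lft_pgl // -/sg.
have key (u v : F) : ratC (u * a' + v * c') * X + ratC (u * b' + v * d') =
    (ratC u * ((ratC a' * X + ratC b') / (ratC c' * X + ratC d')) + ratC v) *
    (ratC c' * X + ratC d').
  by rewrite mulrDl -mulrA divfK // !rmorphD !rmorphM /=; ring.
by rewrite !key -mulf_div divff // mulr1.
Qed.

(** Substituting [s(X)] in [r(X)] gives [r(s(X))]: substitution by [s] is right
multiplication by [s]. *)
Lemma subst0_lft s r : subst s 0 (lft r) = lft (r * s)%g.
Proof.
have [a [b [c [d [D ->]]]]] := pglP r.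
by rewrite subst_lft // !frobE expn0 !expr1.
Qed.

(** Substitution by the inverse of [s] reduces [r(X) = s(X)] to the case where
[s] is the identity. *)
Lemma lft_inj : injective (@lft F).
Proof.
have lftX r : lft r = X -> r = 1%g.
  have [a [b [c [d [D ->]]]]] := pglP r; rewrite lft_pgl //.
  move/(canRL (divfK (lin_neq0 D))); rewrite -!tofracM -!tofracD -tofracM => /eqP.
  rewrite tofrac_eq ['X * _]mulrC => /eqP E.
  have := congr1 (fun h : {poly F} => h`_0) E.
  have := congr1 (fun h : {poly F} => h`_1) E.
  have := congr1 (fun h : {poly F} => h`_2) E.
  rewrite !(coefD, coefMX, coefC) /= !(addr0, add0r).
  move=> c0 aE bE; rewrite -pgl1; apply/pgl_eq => //; first exact: upper_det.
  exists d; rewrite aE bE -c0 !mulr0 mulr1; split=> //.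
  by apply: contra_neq D => d0; rewrite aE bE d0 !mul0r subrr.
move=> r s E; have := congr1 (subst s^-1%g 0) E.
by rewrite !subst0_lft mulgV lft1 => /lftX/eqP; rewrite -eq_mulgV1 => /eqP.
Qed.

Definition orbit_roots := [seq lft s | s in PGL2 F].

Lemma orbit_polyE : orbit_poly (PGL2 F) = \prod_(z <- orbit_roots) ('X - z%:P).
Proof. by rewrite big_image. Qed.

Lemma orbit_roots_uniq : uniq orbit_roots.
Proof. by rewrite map_inj_uniq ?enum_uniq //; exact: lft_inj. Qed.

Lemma orbit_rootsP z : reflect (exists s, z = lft s) (z \in orbit_roots).
Proof.
apply: (iffP imageP) => [[s _ ->]|[s ->]]; first by exists s.
by exists s; rewrite ?memPGL2.
Qed.

Lemma size_orbit_roots : size orbit_roots = #|PGL2 F|.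
Proof. exact: size_image. Qed.

(** An injective map of the finite set of roots into itself permutes it. *)
Lemma subst_orbit_poly s j :
  map_poly (subst s j) (orbit_poly (PGL2 F)) = orbit_poly (PGL2 F).
Proof.
rewrite orbit_polyE rmorph_prod /=.
transitivity (\prod_(z <- map (subst s j) orbit_roots) ('X - z%:P)).
  by rewrite big_map; apply: eq_bigr => z _; rewrite rmorphB /= map_polyX map_polyC.
apply: perm_big.
have Us : uniq (map (subst s j) orbit_roots).
  by rewrite map_inj_uniq ?orbit_roots_uniq //; apply: fmorph_inj.
have sub : {subset map (subst s j) orbit_roots <= orbit_roots}.
  move=> _ /mapP[_ /orbit_rootsP[r ->] ->]; apply/orbit_rootsP.
  have [a [b [c [d [D ->]]]]] := pglP r.
  by rewrite subst_lft //; eexists.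
apply: uniq_perm => //; first exact: orbit_roots_uniq.
by have [|_] := uniq_min_size Us sub; rewrite ?size_map.
Qed.

End Substitutions.

(** * Coefficients of the orbit polynomial *)

(** Each factor has degree at most 1 in the inner variable. *)
Lemma size_coef_prod (R : nzRingType) (I : Type) (r : seq I)
    (H : I -> {poly {poly R}}) k :
    (forall i j, (size ((H i)`_j)%R <= 2)%N) ->
  (size ((\prod_(i <- r) H i)`_k)%R <= (size r).+1)%N.
Proof.
move=> H2; elim: r k => [|i r IHr] k.
  by rewrite big_nil coef1; case: (k == 0); rewrite ?size_poly1 ?size_poly0.
rewrite big_cons coefM; apply: (leq_trans (size_sum _ _ _)).
apply/bigmax_leqP => j _; apply: leq_trans (size_polyMleq _ _) _.
by rewrite -subn1 leq_subLR add1n -add2n leq_add.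
Qed.

Section OrbitCoefficient.
Variables (p : nat) (F : finFieldType) (pF : p \in [pchar F]).
Variables (i : nat) (f g : {poly F}).
Local Notation gT := (coset_of 'Z('GL_2[F])).
Local Notation KX := {fraction {poly F}}.
Local Notation Phi := (tofrac f / tofrac g).
Hypothesis coefE : (orbit_poly (PGL2 F))`_i = Phi.
Hypothesis nonconst : forall c : F, (orbit_poly (PGL2 F))`_i <> ratC c.
Hypothesis fg_coprime : coprimep f g.

Lemma coef_nonconst c : Phi <> ratC c.
Proof. by rewrite -coefE; apply: nonconst. Qed.

Lemma numer_neq0 : f != 0.
Proof.
by apply/eqP=> f0; apply: (@coef_nonconst 0); rewrite f0 rmorph0 mul0r rmorph0.
Qed.

Lemma denom_neq0 : g != 0.
Proof.
by apply/eqP=> g0; apply: (@coef_nonconst 0); rewrite g0 rmorph0 invr0 mulr0 rmorph0.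
Qed.

Lemma subst_coef s j : subst pF s j Phi = Phi.
Proof. by rewrite -coefE -[in RHS](subst_orbit_poly pF s j) coef_map. Qed.

(** Let [sg f] be the Frobenius conjugate of [f].  As [f / g] is fixed,
[sg f * g = f * sg g], so by coprimality [f] divides [sg f], which has the same
size; hence [sg f] is a multiple of [f], and equal to it if [f] is monic.  The
same argument applies to [g]. *)
Lemma coef_frob_fixed : (f \is monic) || (g \is monic) ->
  map_poly (frob pF 1) f = f /\ map_poly (frob pF 1) g = g.
Proof.
pose sg := map_poly (frob pF 1); rewrite -!/(sg _) => mon.
have sg0 h : (sg h == 0) = (h == 0) by apply: map_poly_eq0.
have E : sg f * g = f * sg g.
  have := subst_coef 1%g 1; rewrite fmorph_div /= !subst_tofrac.
  rewrite -!/(sg _) lft1 !ratCX_horner.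
  move/eqP; rewrite eqr_div ?tofrac_eq0 ?sg0 ?denom_neq0 // -!tofracM tofrac_eq.
  by move/eqP.
have monic_eq h h' : h \is monic -> sg h * h' = h * sg h' -> coprimep h h' -> sg h = h.
  move=> hm hE co; have : h %| sg h by rewrite -(Gauss_dvdpl _ co) hE dvdp_mulr.
  move/dvdp_size_eqp; rewrite /sg size_map_poly eqxx => /esym hh; apply/esym/eqP.
  by rewrite -eqp_monic // /sg monic_map.
have [fm|gm] := orP mon.
  have fE : sg f = f by apply: (monic_eq _ g).
  by split=> //; move: E; rewrite fE => /(mulfI numer_neq0).
have gE : sg g = g.
  by apply: (monic_eq _ f); rewrite 1?coprimep_sym // [LHS]mulrC [RHS]mulrC.
by split=> //; move: E; rewrite gE => /(mulIf denom_neq0).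
Qed.

(** Multiplying the orbit polynomial by the product [D] of the denominators of
the [s(X)] turns its coefficients into polynomials of degree at most [#|G|];
since [f / g] is in lowest terms, [f] divides one of them and [g] divides [D]. *)
Lemma size_numer_denom : (size f <= #|PGL2 F|.+1)%N /\ (size g <= #|PGL2 F|.+1)%N.
Proof.
have /fin_all_exists[nd ndP] (s : gT) : exists nd : {poly F} * {poly F},
    [/\ (size nd.1 <= 2)%N, (size nd.2 <= 2)%N, nd.2 != 0
      & lft s = tofrac nd.1 / tofrac nd.2].
  have [a [b [c [d [D ->]]]]] := pglP s.
  exists (a%:P * 'X + b%:P, c%:P * 'X + d%:P) => /=; rewrite !size_MXaddC.
  rewrite lft_pgl //; have := lin_neq0 D; rewrite -!tofracM -!tofracD tofrac_eq0 => ->.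
  by split=> //; case: ifP => // _; rewrite ltnS size_polyC leq_b1.
pose e := enum (PGL2 F).
have se : size e = #|PGL2 F| by rewrite -cardE.
pose N := \prod_(s <- e) ((nd s).2 *: 'X - (nd s).1%:P).
pose D := \prod_(s <- e) (nd s).2.
have D0 : D != 0.
  by rewrite prodf_seq_neq0; apply/allP=> s _; have [_ _ ->] := ndP s.
have NE : map_poly (@tofrac {poly F}) N = tofrac D *: orbit_poly (PGL2 F).
  rewrite /orbit_poly /N /D !rmorph_prod /= -big_enum -/e -scaler_prod /=.
  apply: eq_bigr => s _; have [_ _ nz ->] := ndP s.
  rewrite rmorphB /= linearZ /= map_polyX map_polyC scalerBr; congr (_ - _).
  by rewrite -mul_polyC -polyCM mulrC divfK // tofrac_eq0.
have sN k : (size (N`_k)%R <= #|PGL2 F|.+1)%N.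
  rewrite -se; apply: size_coef_prod => s j; have [s1 s2 _ _] := ndP s.
  rewrite coefB coefZ coefX coefC.
  apply: leq_trans (size_polyD _ _) _; rewrite size_polyN geq_max.
  by case: (j == 1); case: (j == 0); rewrite ?mulr1 ?mulr0 ?size_poly0 ?s1 ?s2.
have sD : (size D <= #|PGL2 F|.+1)%N.
  have := @size_coef_prod F gT e (fun s => (nd s).2%:P) 0.
  rewrite -rmorph_prod /= coefC eqxx se; apply=> s j; rewrite coefC.
  by have [_ s2 _ _] := ndP s; case: ifP; rewrite ?size_poly0.
have E : N`_i * g = D * f.
  have := congr1 (fun h : {poly KX} => h`_i) NE.
  rewrite coef_map coefZ coefE /= => E.
  apply/eqP; rewrite -tofrac_eq !tofracM E -mulrA divfK //.
  by rewrite tofrac_eq0 denom_neq0.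
split.
  have : f %| N`_i by rewrite -(Gauss_dvdpl _ fg_coprime) E dvdp_mull.
  move/dvdp_leq => /(_ _)/leq_trans; apply=> //.
  by apply: contra_neq (mulf_neq0 D0 numer_neq0) => N0; rewrite -E N0 mul0r.
have gf_coprime : coprimep g f by rewrite coprimep_sym.
have : g %| D by rewrite -(Gauss_dvdpl _ gf_coprime) -E dvdp_mull.
by move/dvdp_leq => /(_ D0)/leq_trans; apply.
Qed.

(** The polynomial whose roots are the points of the fibre of [Phi] through the
generic point [X]. *)
Definition generic_fiber := map_poly (@ratC F) f - Phi *: map_poly (@ratC F) g.

(** Applying the substitution by [s] to [Phi(X) = Phi] gives [Phi(s(X)) = Phi],
which provides [#|G|] distinct roots; the degree leaves room for no others. *)
Lemma generic_fiber_orbit : orbit_poly (PGL2 F) %= generic_fiber.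
Proof.
have u0 : generic_fiber != 0 := fiber_neq0 f coef_nonconst denom_neq0.
have [sf sg] := size_numer_denom.
have dv : orbit_poly (PGL2 F) %| generic_fiber.
  rewrite orbit_polyE; apply: uniq_roots_dvdp; last first.
    by rewrite uniq_rootsE (orbit_roots_uniq pF).
  apply/allP=> _ /orbit_rootsP[s ->].
  have idE h : map_poly (frob pF 0) h = h.
    by rewrite map_poly_id // => x _; rewrite frobE expn0 expr1.
  have := subst_coef s 0; rewrite fmorph_div /= !subst_tofrac !idE => E.
  rewrite /root /generic_fiber hornerD hornerN hornerZ -E divfK ?subrr //.
  rewrite -[map_poly _ g]/(map_poly (@ratC F) g) -[g]idE -subst_tofrac fmorph_eq0.
  by rewrite tofrac_eq0 denom_neq0.
have sorb : size (orbit_poly (PGL2 F)) = #|PGL2 F|.+1.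
  by rewrite orbit_polyE size_prod_XsubC size_orbit_roots.
rewrite -dvdp_size_eqp // eqn_leq dvdp_leq //= sorb.
apply: leq_trans (size_polyD _ _) _; rewrite size_polyN geq_max size_map_poly sf.
by apply: leq_trans (size_scale_leq _ _) _; rewrite size_map_poly.
Qed.

End OrbitCoefficient.

(** * The splitting field contains the rational function field *)
Section SplittingField.
Variables (p n : nat) (F : finFieldType) (pF : p \in [pchar F]).
Hypothesis cardF : #|F| = (p ^ n)%N.
Variables (i : nat) (f0 g0 : {poly 'F_p}).
Local Notation f := (map_poly (ofFp pF) f0).
Local Notation g := (map_poly (ofFp pF) g0).
Local Notation gT := (coset_of 'Z('GL_2[F])).
Local Notation K := {fraction {poly 'F_p}}.
Local Notation KX := {fraction {poly F}}.
Local Notation Phi := (tofrac f / tofrac g).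
Hypothesis coefE : (orbit_poly (PGL2 F))`_i = Phi.
Hypothesis nonconst : forall c : F, (orbit_poly (PGL2 F))`_i <> ratC c.
Hypothesis fg_coprime : coprimep f g.
Variable L : splittingFieldType K.
Local Notation P := (map_poly (in_alg L) (fiber_poly f0 g0)).

Lemma coef_transcendental : ~ algebraicOver (@ratC F \o ofFp pF) Phi.
Proof.
move/algebraic_comp; apply: nonconstant_transcendental.
exact: (coef_nonconst coefE nonconst).
Qed.

(** The base field sits in [F(X)] with its variable sent to [Phi]. *)
Definition kappa : K -> KX := ratmap coef_transcendental.
HB.instance Definition _ := GRing.RMorphism.on kappa.

Lemma kappaC c : kappa (ratC c) = ratC (ofFp pF c).
Proof. exact: ratmapC. Qed.

Lemma kappaX : kappa (ratX 'F_p) = Phi.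
Proof. exact: ratmapX. Qed.

Lemma kappa_fiber : map_poly kappa (fiber_poly f0 g0) = generic_fiber f g.
Proof.
rewrite /fiber_poly rmorphB /= map_polyZ /= [kappa _]ratmapX -!map_poly_comp.
rewrite /generic_fiber -!map_poly_comp.
by congr (_ - _ *: _); apply: eq_map_poly => c /=; apply: ratmapC.
Qed.

Lemma size_fiber_L : size P = #|PGL2 F|.+1.
Proof.
rewrite size_map_poly -(size_map_poly kappa) kappa_fiber.
rewrite -(eqp_size (generic_fiber_orbit pF coefE nonconst fg_coprime)).
by rewrite orbit_polyE size_prod_XsubC size_orbit_roots.
Qed.

Definition Fp_to_L : 'F_p -> L := in_alg L \o @ratC 'F_p.
HB.instance Definition _ := GRing.RMorphism.on Fp_to_L.
Local Notation e := Fp_to_L.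
Local Notation t := (in_alg L (ratX 'F_p)).

Lemma fiber_LE : P = map_poly e f0 - t *: map_poly e g0.
Proof. by rewrite /fiber_poly rmorphB /= map_polyZ -!map_poly_comp. Qed.

Lemma t_transcendental : ~ algebraicOver e t.
Proof.
case=> h h0; rewrite /root map_poly_comp horner_map /= ratCX_horner.
by rewrite scaler_eq0 oner_eq0 orbF tofrac_eq0 (negPf h0).
Qed.

(** A root [y] is not a pole of [Phi]: otherwise [f0] and [g0] would have the
common root [y]. *)
Lemma fiber_rootP y : root P y ->
  (map_poly e g0).[y] != 0 /\ t = (map_poly e f0).[y] / (map_poly e g0).[y].
Proof.
rewrite fiber_LE /root hornerD hornerN hornerZ subr_eq0 => /eqP E.
have g0y : (map_poly e g0).[y] != 0.
  have co : coprimep (map_poly e f0) (map_poly e g0).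
    by rewrite coprimep_map -(coprimep_map (ofFp pF)).
  apply/eqP=> gy0; move: E; rewrite gy0 mulr0 => /eqP/(coprimep_root co).
  by rewrite gy0 eqxx.
by split=> //; rewrite E mulfK.
Qed.

(** If [y] were algebraic over the prime field, so would be [t = Phi(y)]. *)
Lemma root_transcendental y : root P y -> ~ algebraicOver e y.
Proof.
case/fiber_rootP=> gy tE /integral_algebraic inty; apply: t_transcendental.
apply/integral_algebraic; rewrite tE.
have intC c : integralOver e (e c).
  exists ('X - c%:P); first exact: monicXsubC.
  by rewrite rmorphB /= map_polyX map_polyC root_XsubC.
have inth (h : {poly 'F_p}) : integralOver e (map_poly e h).[y].
  apply: integral_horner => // _ /(nthP 0)[k _ <-].
  by rewrite coef_map; apply: intC.
exact: integral_div.
Qed.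

Hypothesis splitP : splittingFieldFor 1 P {:L}.

Lemma fiber_has_root : exists y, root P y.
Proof.
have [[|y rs] Prs _] := splitP.
  have := eqp_size Prs; rewrite size_fiber_L big_nil size_poly1 => -[] /eqP.
  by rewrite -leqn0 leqNgt cardG_gt0.
by exists y; rewrite (eqp_root Prs) big_cons rootM root_XsubC eqxx.
Qed.

(** Let [m0] be the minimal polynomial of a generator [w] of [F].  Over [F(X)],
the polynomial [m0(T - X)] is the product of the [T - X - c] with [c] conjugate
to [w], hence divides the generic fibre polynomial.  Both are defined over
[F_p(X)], so the divisibility holds there, and specialising [X] to [y] shows
that [m0(T - y)] splits in [L].  This yields a root of [m0] in [L]. *)
Lemma exists_constants_embedding : exists (io : {rmorphism F -> L}) y,
  root P y /\ ~ algebraicOver io y.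
Proof.
have [y Py] := fiber_has_root; have tr := root_transcendental Py.
have [w wgen] := finField_powers F.
have [m0 m0E] := exists_conjugates_poly pF cardF w.
have trX : ~ algebraicOver (@ratC F \o ofFp pF) (ratX F).
  by move/algebraic_comp; apply: ratX_transcendental.
pose mu : {rmorphism K -> KX} := ratmap trX.
pose phi0 : {rmorphism K -> L} := ratmap tr.
pose A0 : {poly K} := map_poly (@ratC 'F_p) m0 \Po ('X - (ratX 'F_p)%:P).
pose u0 : {poly K} := map_poly (@ratC 'F_p) f0
   - (tofrac f0 / tofrac g0) *: map_poly (@ratC 'F_p) g0.
have muC c : mu (ratC c) = ratC (ofFp pF c) by apply: ratmapC.
have mu_poly h : map_poly mu (map_poly (@ratC 'F_p) h) =
    map_poly (@ratC F) (map_poly (ofFp pF) h).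
  by rewrite -!map_poly_comp; apply: eq_map_poly => c; apply: muC.
have mu_frac h : mu (tofrac h) = tofrac (map_poly (ofFp pF) h).
  by rewrite [mu _]ratmap_tofrac map_poly_comp ratCX_horner.
have mu_u0 : map_poly mu u0 = generic_fiber f g.
  by rewrite /u0 rmorphB /= map_polyZ !mu_poly fmorph_div /= !mu_frac.
have mu_A0 : map_poly mu A0 =
    \prod_(z <- [seq ratX F + ratC (frob pF j w) | j <- iota 0 n]) ('X - z%:P).
  have -> : map_poly mu A0 =
      map_poly (@ratC F) (map_poly (ofFp pF) m0) \Po ('X - (ratX F)%:P).
    rewrite map_comp_poly mu_poly rmorphB /= map_polyX map_polyC /=.
    by rewrite [mu _]ratmapX.
  rewrite m0E -(big_mkord xpredT (fun j => 'X - (frob pF j w)%:P)) big_map.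
  rewrite /index_iota subn0 rmorph_prod /= (rmorph_prod (comp_poly _)) /=.
  apply: eq_bigr => j _; rewrite rmorphB /= map_polyX map_polyC /=.
  by rewrite rmorphB /= comp_polyX comp_polyC polyCD opprD addrA.
have dvd_mu : map_poly mu A0 %| map_poly mu u0.
  rewrite mu_A0 mu_u0; apply: uniq_roots_dvdp.
    apply/allP=> _ /mapP[j _ ->]; set c := frob pF j w.
    rewrite -(eqp_root (generic_fiber_orbit pF coefE nonconst fg_coprime)).
    rewrite orbit_polyE root_prod_XsubC.
    apply/orbit_rootsP; exists (upper c).
    by rewrite lft_pgl ?upper_det // !rmorph1 rmorph0 mul1r mul0r add0r divr1.
  rewrite uniq_rootsE map_inj_in_uniq ?iota_uniq // => j k.
  rewrite !mem_iota !add0n /= => jn kn /addrI/(fmorph_inj (@ratC F)).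
  exact: (frob_gen_inj cardF wgen).
(* [mu] extends the constants of [F_p(X)] to [F], [phi0] specialises [X] to [y]. *)
have : map_poly phi0 A0 %| map_poly phi0 u0 by rewrite dvdp_map -(dvdp_map mu).
have -> : map_poly phi0 u0 = P.
  rewrite fiber_LE; have [_ ->] := fiber_rootP Py.
  rewrite /u0 rmorphB /= map_polyZ -!map_poly_comp fmorph_div /=.
  rewrite ![phi0 _]ratmap_tofrac.
  by congr (_ - _ *: _); apply: eq_map_poly => c; apply: ratmapC.
have -> : map_poly phi0 A0 = map_poly e m0 \Po ('X - y%:P).
  rewrite map_comp_poly rmorphB /= map_polyX map_polyC /= [phi0 _]ratmapX.
  rewrite -map_poly_comp.
  by congr (_ \Po _); apply: eq_map_poly => c; apply: ratmapC.
have [rs Prs _] := splitP.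
rewrite (eqp_dvdr _ Prs) => /dvdp_prod_XsubC[m Hm].
have [b mb] : exists b, root (map_poly e m0) b.
  have := eqp_size Hm; rewrite size_comp_poly2 ?size_XsubC // size_map_poly.
  rewrite (size_conjugates_poly m0E) size_prod_XsubC => -[].
  case: (mask m rs) Hm => [|z zs] Hm /=.
    by have := field_degree_gt0 cardF; case: (n).
  exists (z - y); have := eqp_root Hm z.
  by rewrite big_cons rootM root_XsubC eqxx /root horner_comp !hornerE.
have [io] := finField_embedding cardF wgen m0E mb.
(* The image of [F] is algebraic over the prime field, so [y] stays transcendental. *)
exists io, y; split=> // -[h h0 hy]; apply: (tr); apply/integral_algebraic.
apply: (integral_root _ hy); first by rewrite map_poly_eq0.
move=> _ /(nthP 0)[k _ <-]; rewrite coef_map /=; set c := h`_k.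
exists ('X^#|F| - 'X).
  rewrite monicE lead_coefDl ?lead_coefXn // size_polyN size_polyX size_polyXn.
  by rewrite ltnS card_finRing_gt1.
rewrite rmorphB /= map_polyXn map_polyX /root !hornerE.
by rewrite -rmorphXn /= expf_card subrr.
Qed.

Lemma exists_ratmap (E : fieldType) (io : {rmorphism F -> E}) (y : E) :
  ~ algebraicOver io y ->
  exists phi : {rmorphism KX -> E}, [/\ forall c, phi (ratC c) = io c,
    phi (ratX F) = y & forall h, phi (tofrac h) = (map_poly io h).[y]].
Proof.
move=> tr; exists (ratmap tr).
by split; [exact: ratmapC | exact: ratmapX | exact: ratmap_tofrac].
Qed.

(** Sending [X] to a root [y] sends [Phi] to [Phi(y) = t], so the two embeddings
of the base field in [L] agree on its generator. *)
Lemma exists_function_field_embedding : exists phi : {rmorphism KX -> L},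
  forall k, in_alg L k = phi (kappa k).
Proof.
have [io [y [Py tr]]] := exists_constants_embedding.
have [phi [phiC phiX phi_tofrac]] := exists_ratmap tr.
have eqFp c : e c = io (ofFp pF c) by exact: (Fp_morph_eq e (io \o ofFp pF) c).
have eq_poly h : map_poly io (map_poly (ofFp pF) h) = map_poly e h.
  by rewrite -map_poly_comp; apply: eq_map_poly => c /=; rewrite eqFp.
pose iA : {rmorphism K -> L} := in_alg L.
have eE c : e c = iA (ratC c) by [].
have tE : iA (ratX 'F_p) = _ := (fiber_rootP Py).2.
exists phi => k; rewrite -[in_alg L k]/(iA k).
move: iA eE tE => iA eE tE.
have eqC c : iA (ratC c) = phi (kappa (ratC c)) by rewrite kappaC phiC -eqFp eE.
have eqX : iA (ratX 'F_p) = phi (kappa (ratX 'F_p)).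
  by rewrite tE kappaX fmorph_div /= !phi_tofrac !eq_poly.
exact: (ratmorph_ext (g := phi \o kappa) eqC eqX k).
Qed.

Lemma fiber_L_split (phi : {rmorphism KX -> L}) :
    (forall k, in_alg L k = phi (kappa k)) ->
  P %= \prod_(z <- map phi (orbit_roots F)) ('X - z%:P).
Proof.
move=> in_algE.
have -> : P = map_poly phi (generic_fiber f g).
  rewrite -kappa_fiber -map_poly_comp.
  by apply: eq_map_poly => k; apply: in_algE.
have -> : \prod_(z <- map phi (orbit_roots F)) ('X - z%:P) =
    map_poly phi (orbit_poly (PGL2 F)).
  rewrite orbit_polyE rmorph_prod big_map; apply: eq_bigr => z _.
  by rewrite rmorphB /= map_polyX map_polyC.
by rewrite eqp_map eqp_sym (generic_fiber_orbit pF coefE nonconst fg_coprime).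
Qed.

End SplittingField.

(** * The Galois group *)

(** Commuting with [upper 1] forces [s] to be upper triangular with equal
diagonal entries, commuting with [lower 1] forces it to be lower triangular. *)
Lemma commute_unipotents (F : finFieldType) (s : coset_of 'Z('GL_2[F])) :
  (s * upper 1 = upper 1 * s)%g -> (s * lower 1 = lower 1 * s)%g -> s = 1%g.
Proof.
have [a [b [c [d [D ->]]]]] := pglP s.
rewrite (mul_upper _ D) (upper_mul _ D) (mul_lower _ D) (lower_mul _ D).
case/pgl_eq=> [||k [k0 Ea Eb Ec Ed]]; try by apply: contra_neq D => <-; ring.
case/pgl_eq=> [||m [m0 Fa Fb Fc Fd]]; try by apply: contra_neq D => <-; ring.
have c0 : c = 0.
  apply/eqP; apply: contraTT isT => c0.
  have k1 : k = 1 by apply: (mulIf c0); rewrite mul1r -Ec.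
  move: Ed c0; rewrite k1 mul1r mulr1 => /(canRL (addrK _)).
  by rewrite subrr => ->; rewrite eqxx.
have b0 : b = 0.
  apply/eqP; apply: contraTT isT => b0.
  have m1 : m = 1 by apply: (mulIf b0); rewrite mul1r -Fb.
  move: Fa b0; rewrite m1 mul1r mulr1 => /(canRL (addKr _)).
  by rewrite addNr => ->; rewrite eqxx.
have d0 : d != 0 by apply: contra_neq D => ->; rewrite c0; ring.
have k1 : k = 1 by apply: (mulIf d0); rewrite -Ed c0; ring.
have ad : a = d by move: Eb; rewrite k1 b0; rewrite !(mul1r, mulr1, addr0, add0r).
rewrite -pgl1; apply/pgl_eq => //; first exact: upper_det.
by exists d; rewrite ad b0 c0 !mulr0 mulr1.
Qed.

Section GaloisGroup.
Variables (p n : nat) (F : finFieldType) (pF : p \in [pchar F]).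
Hypothesis cardF : #|F| = (p ^ n)%N.
Local Notation gT := (coset_of 'Z('GL_2[F])).
Local Notation K := {fraction {poly 'F_p}}.
Local Notation KX := {fraction {poly F}}.
Variables (L : splittingFieldType K) (P0 : {poly K}).
Local Notation P := (map_poly (in_alg L) P0).
Local Notation Gal := ('Gal({:L} / 1))%g.
Variables (kap : {rmorphism K -> KX}) (phi : {rmorphism KX -> L}).
Hypothesis splitP : splittingFieldFor 1 P {:L}.
Hypothesis kapC : forall c, kap (ratC c) = ratC (ofFp pF c).
Hypothesis substPhi : forall s j, subst pF s j (kap (ratX 'F_p)) = kap (ratX 'F_p).
Hypothesis in_algE : forall k, in_alg L k = phi (kap k).
Hypothesis fiber_L_split : P %= \prod_(z <- map phi (orbit_roots F)) ('X - z%:P).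

Lemma root_fiber z : root P z = (z \in map phi (orbit_roots F)).
Proof. by rewrite (eqp_root fiber_L_split) root_prod_XsubC. Qed.

(** The image of [phi] is a field that contains the base field and all roots. *)
Lemma phi_surj z : exists x, phi x == z.
Proof.
have [rs Prs rsL] := splitP.
have: z \in <<1 & rs>>%VS by rewrite rsL memvf.
have: {in rs, forall z, exists x, phi x == z}.
  move=> x xrs; have: root P x by rewrite (eqp_root Prs) root_prod_XsubC.
  by rewrite root_fiber => /mapP[v _ ->]; exists v.
elim/last_ind: rs {Prs rsL} z => [|rs x IHrs] z rsP.
  by rewrite Fadjoin_nil => /vlineP[k ->]; exists (kap k); rewrite -in_algE.
rewrite adjoin_rcons => /Fadjoin_polyP[h hP ->].
have [|a /eqP <-] := rsP x; first by rewrite mem_rcons mem_head.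
rewrite horner_coef; elim/big_ind: _ => [|u v [b /eqP <-] [c /eqP <-]|j _].
- by exists 0; rewrite rmorph0.
- by exists (b + c); rewrite rmorphD.
have [|b /eqP <-] := IHrs h`_j _ (polyOverP hP j).
  by move=> v vrs; apply: rsP; rewrite mem_rcons inE vrs orbT.
by exists (b * a ^+ j); rewrite rmorphM rmorphXn.
Qed.

Definition phi_inv z := xchoose (phi_surj z).

Lemma phi_invK : cancel phi_inv phi.
Proof. by move=> z; apply/eqP/(xchooseP (phi_surj z)). Qed.

Lemma phiK : cancel phi phi_inv.
Proof. by move=> x; apply: (fmorph_inj phi); rewrite phi_invK. Qed.

(** Through the isomorphism [phi], an endomorphism of [F(X)] becomes an
endomorphism of [L]; it is linear over the base field because it fixes the
image of the variable, and prime field constants are always fixed. *)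
Lemma gal_lift (psi : {rmorphism KX -> KX}) :
  psi (kap (ratX 'F_p)) = kap (ratX 'F_p) ->
  {x | x \in Gal & forall a, x (phi a) = phi (psi a)}.
Proof.
move=> psiPhi.
have psikC c : psi (kap (ratC c)) = kap (ratC c).
  rewrite kapC.
  exact: (Fp_morph_eq (psi \o (@ratC F \o ofFp pF)) (@ratC F \o ofFp pF)).
have psik k : psi (kap k) = kap k.
  exact: (ratmorph_ext (f := psi \o kap) (g := kap) psikC psiPhi k).
pose h z := phi (psi (phi_inv z)).
have hphi a : h (phi a) = phi (psi a) by rewrite /h phiK.
have scaleE k u : k *: u = phi (kap k) * u by rewrite -in_algE mulr_algl.
have h_lin : linear h.
  move=> k u v; rewrite -(phi_invK u) -(phi_invK v).
  by rewrite !scaleE -rmorphM -rmorphD !hphi rmorphD rmorphM psik rmorphD rmorphM.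
pose hl : {linear L -> L} :=
  HB.pack_for {linear L -> L} h (GRing.isLinear.Build K L L *:%R h h_lin).
have hlE z : linfun hl z = h z by rewrite lfunE.
have hH : kHom 1 {:L} (linfun hl).
  apply/kHomP_tmp; split=> [_ /vlineP[k ->]|u v _ _]; rewrite !hlE.
    by rewrite scaleE mulr1 hphi psik.
  by rewrite -(phi_invK u) -(phi_invK v) -rmorphM !hphi !rmorphM.
have [|x xG xE] := kHom_to_gal _ (normalFieldf 1) hH; first by rewrite sub1v subvv.
exists x => // a; rewrite -xE ?memvf // hlE; exact: hphi.
Qed.

Definition gal_subst s j := s2val (gal_lift (substPhi s j)).

Lemma mem_gal_subst s j : gal_subst s j \in Gal.
Proof. by rewrite /gal_subst; case: gal_lift. Qed.

Lemma gal_substE s j a : gal_subst s j (phi a) = phi (subst pF s j a).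
Proof. by rewrite /gal_subst; case: gal_lift => /= x _ ->. Qed.

(** [L] is generated, as a field, by the constants and one root. *)
Lemma gal_ext (x z : gal_of {:L}) : (forall c, x (phi (ratC c)) = z (phi (ratC c))) ->
  x (phi (ratX F)) = z (phi (ratX F)) -> x = z.
Proof.
move=> xzC xzX; apply/eqP/gal_eqP => v _; rewrite -(phi_invK v).
exact: (ratmorph_ext (f := x \o phi) (g := z \o phi) xzC xzX).
Qed.

Lemma galM_phi (x z : gal_of {:L}) v : (x * z)%g v = z (x v).
Proof. by rewrite galM ?memvf. Qed.

Lemma gal_root (x : gal_of {:L}) : x \in Gal -> exists s, x (phi (ratX F)) = phi (lft s).
Proof.
move=> xG; have: root P (x (phi (ratX F))).
  have -> : P = map_poly x P.
    rewrite -map_poly_comp; apply: eq_map_poly => k /=.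
    by rewrite -[LHS](fixed_gal (sub1v _) xG) // memvZ ?mem1v.
  by rewrite rmorph_root // root_fiber map_f // -lft1; apply/orbit_rootsP; exists 1%g.
by rewrite root_fiber => /mapP[_ /orbit_rootsP[s ->] ->]; exists s.
Qed.

(** The constants are the roots of [X ^ q - X], so they are permuted. *)
Lemma gal_const (x : gal_of {:L}) c : exists c', x (phi (ratC c)) = phi (ratC c').
Proof.
have := congr1 (map_poly (phi \o @ratC F)) (finField_genPoly F).
rewrite rmorphB /= map_polyXn map_polyX rmorph_prod /=.
move/(congr1 (horner^~ (x (phi (ratC c))))).
rewrite !hornerE -rmorphXn /= -!rmorphXn /= expf_card subrr horner_prod.
move/esym/eqP; rewrite prodf_seq_eq0 => /hasP[c' _] /=.
by rewrite rmorphB /= map_polyX map_polyC !hornerE subr_eq0 => /eqP->; exists c'.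
Qed.

(** The order of multiplication is preserved: a product of Galois automorphisms
applies the left factor first, and substitution by [s] turns [r(X)] into
[(r * s)(X)]. *)
Lemma gal_subst0M r s : gal_subst (r * s)%g 0 = (gal_subst r 0 * gal_subst s 0)%g.
Proof.
apply: gal_ext => [c|].
  rewrite galM_phi (gal_substE (r * s)%g) (gal_substE r) (gal_substE s).
  by rewrite !substC !frobE expn0 !expr1.
rewrite galM_phi (gal_substE (r * s)%g) (gal_substE r) (gal_substE s).
by rewrite !substX subst0_lft.
Qed.

Lemma gal_subst_inj w : (forall x : F, x != 0 -> exists k, x = w ^+ k) ->
  injective (fun x : gT * 'I_n => gal_subst x.1 x.2).
Proof.
move=> wgen [s j] [r k] /= E.
have Ea a : subst pF s j a = subst pF r k a.
  by apply: (fmorph_inj phi); rewrite -!gal_substE E.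
have <- : s = r by apply: (lft_inj pF); rewrite -(substX pF s j) Ea substX.
congr (_, _); apply: val_inj; apply: (frob_gen_inj cardF wgen); rewrite ?inE ?ltn_ord //=.
by apply: (fmorph_inj (@ratC F)); have := Ea (ratC w); rewrite !substC.
Qed.

Lemma card_Gal_ge : (n * #|PGL2 F| <= #|Gal|)%N.
Proof.
have [w wgen] := finField_powers F.
have -> : (n * #|PGL2 F| = #|{: gT * 'I_n}|)%N.
  by rewrite card_prod card_ord mulnC PGL2_full cardsT.
rewrite -(card_imset _ (gal_subst_inj wgen)) subset_leq_card //.
by apply/subsetP=> _ /imsetP[x _ ->]; apply: mem_gal_subst.
Qed.

Definition gal_subst_morphism := Morphism (D := PGL2 F) (in2W gal_subst0M).
Definition const_gal := (gal_subst_morphism @* PGL2 F)%G.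

Lemma injm_gal_subst : ('injm gal_subst_morphism)%g.
Proof.
apply/injmP=> r s _ _ /= E; apply: (lft_inj pF); apply: (fmorph_inj phi).
by rewrite -!(substX pF _ 0) -!gal_substE E.
Qed.

(** An automorphism that fixes the constants is determined by the root [s(X)] to
which it sends [X], so it is the substitution by [s]. *)
Lemma const_galP x :
  reflect (x \in Gal /\ forall c, x (phi (ratC c)) = phi (ratC c))
          (x \in const_gal).
Proof.
apply: (iffP morphimP) => [[s _ _ ->] /=|[xG xC]].
  by split=> [|c]; rewrite ?mem_gal_subst // gal_substE substC frobE expn0 expr1.
have [s xX] := gal_root xG; exists s; rewrite ?memPGL2 //=.
by apply: gal_ext => [c|]; rewrite gal_substE ?substC ?substX // frobE expn0 expr1.
Qed.

Lemma const_gal_norm : (Gal \subset 'N(const_gal))%g.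
Proof.
apply/subsetP=> x xG; rewrite inE; apply/subsetP=> _ /imsetP[z /const_galP[zG zC] ->].
apply/const_galP; split=> [|c]; first by rewrite groupJ.
have [c' xc'] := gal_const x^-1%g c.
by rewrite conjgE !galM_phi xc' zC -xc' -galM_phi mulVg gal_id.
Qed.

(** Let [x] centralise the substitutions and send [X] to [s(X)].  Since [x] fixes
the coefficients of [X + 1] and [X / (X + 1)], the element [s] commutes with
the two corresponding unipotent elements, so it is trivial and [x] fixes [X].
Commuting with [X |-> X + c] then shows that [x] fixes every constant [c]. *)
Lemma const_gal_cent : ('C_Gal(const_gal) = 1)%g.
Proof.
apply/trivgP/subsetP=> x /setIP[xG /centP xN]; rewrite inE; apply/eqP.
have [s xX] := gal_root xG.
have comm r : phi (lft (s * r)%g) = x (phi (lft r)).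
  have rN : gal_subst r 0 \in const_gal.
    by apply: (mem_morphim gal_subst_morphism); exact: memPGL2.
  have := congr1 (fun z : gal_of _ => z (phi (ratX F))) (xN _ rN).
  by rewrite /= !galM_phi xX !gal_substE subst0_lft substX.
have lft_upper b : lft (upper b) = ratX F + ratC b.
  by rewrite lft_pgl ?upper_det // !rmorph1 rmorph0 mul1r mul0r add0r divr1.
have lft_lower : lft (lower 1) = ratX F / (ratX F + 1).
  by rewrite lft_pgl ?lower_det // !rmorph1 rmorph0 !mul1r addr0.
have s1 : s = 1%g.
  apply: commute_unipotents; apply: (lft_inj pF); apply: (fmorph_inj phi).
    rewrite comm -(subst0_lft pF) lft_upper !rmorph1 !rmorphD !rmorph1 /= xX.
    by rewrite substX.
  have E : subst pF s 0 (lft (lower 1)) = lft s / (lft s + 1).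
    by rewrite lft_lower [LHS]fmorph_div rmorphD rmorph1 /= substX.
  have phiE a : phi (a / (a + 1)) = phi a / (phi a + 1).
    by rewrite fmorph_div rmorphD rmorph1.
  by rewrite comm -(subst0_lft pF) E lft_lower !phiE fmorph_div rmorphD rmorph1 /= xX.
move: xX comm; rewrite s1 lft1 => xX comm.
apply: gal_ext => [c|]; rewrite gal_id //.
have := comm (upper c); rewrite mul1g lft_upper !rmorphD /= xX.
by move/addrI=> <-.
Qed.

(** The kernel of the conjugation action on [const_gal] is its centraliser, so
the Galois group embeds in [Aut const_gal]; the bounds on both orders leave no
gap. *)
Lemma Gal_Aut : (Gal \isog Aut (PGL2 F))%g /\ #|Gal| = (n * #|PGL2 F|)%N.
Proof.
have AN : (Aut const_gal \isog Aut (PGL2 F))%g := injm_Aut injm_gal_subst (subxx _).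
pose c := restrm const_gal_norm (conj_aut const_gal).
have c_inj : ('injm c)%g.
  by rewrite ker_restrm ker_conj_aut const_gal_cent.
have c_sub : (c @* Gal)%g \subset Aut const_gal.
  by rewrite morphim_restrm Aut_conj_aut.
have cA : #|(c @* Gal)%g| = #|Gal| by rewrite card_injm.
have ub := card_Aut_PGL2 pF cardF.
have lb := card_Gal_ge.
have le : (#|Gal| <= #|Aut (PGL2 F)|)%N.
  by rewrite -(card_isog AN) -cA subset_leq_card.
have E : #|Gal| = (n * #|PGL2 F|)%N.
  by apply/eqP; rewrite eqn_leq lb (leq_trans le ub).
split=> //; apply: isog_trans (AN).
have cE : (c @* Gal)%g = Aut const_gal.
  by apply/eqP; rewrite eqEcard c_sub cA E (card_isog AN) ub.
by have := sub_isog (subxx _) c_inj; rewrite cE.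
Qed.

End GaloisGroup.

Theorem theorem54 (p n : nat) (F : finFieldType)
    (p_prime : prime p) (cardF : #|F| = (p ^ n)%N)
    (i : nat) (f g : {poly F})
    (coefE : (orbit_poly (PGL2 F))`_i = tofrac f / tofrac g)
    (nonconst : forall c : F, (orbit_poly (PGL2 F))`_i <> ratC c)
    (fg_coprime : coprimep f g)
    (fg_monic : (f \is monic) || (g \is monic)) :
  exists f0 g0 : {poly 'F_p},
    [/\ f = map_poly (@of_Fp p F) f0,
        g = map_poly (@of_Fp p F) g0
      & forall L : splittingFieldType {fraction {poly 'F_p}},
          splittingFieldFor 1 (map_poly (in_alg L) (fiber_poly f0 g0)) {:L} ->
          ('Gal({:L} / 1) \isog Aut (PGL2 F))%g
          /\ #|('Gal({:L} / 1))%g| = (n * #|PGL2 F|)%N].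
Proof.
have pF : p \in [pchar F] := card_finPcharP cardF p_prime.
have [fE gE] := coef_frob_fixed pF coefE nonconst fg_coprime fg_monic.
have [f0 f0E] := frob_fixed_poly fE; have [g0 g0E] := frob_fixed_poly gE.
exists f0, g0; split=> // L splitL.
move: coefE fg_coprime; rewrite f0E g0E => coefE0 coprime0.
have [phi in_algE] :=
  exists_function_field_embedding cardF coefE0 nonconst coprime0 splitL.
apply: (Gal_Aut cardF splitL (kap := kappa coefE0 nonconst) (phi := phi)) => //.
- exact: kappaC.
- by move=> s j; rewrite /= kappaX; apply: (subst_coef pF coefE0).
- exact: fiber_L_split in_algE.
Qed.
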